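(* Let $h_S(x_1,x_2,x_3)=x_1x_2+x_2x_3+x_3x_1$. There is an algorithm running in time $O(n^{1+o(1)})$ which, for $d=O(\log n)$, $\Gamma=o(\sqrt{\log n})$ and $\gamma=1/\mathrm{poly}(n)$, given query-key matrices $Q^{(1)},Q^{(2)},Q^{(3)}\in[-\Gamma,\Gamma]^{n\times d}$ and value matrices $V^{(2)},V^{(3)}\in\mathbb{R}^{n\times d}$, outputs a matrix $\widehat A\in\mathbb{R}^{n\times d}$ with $|\widehat A_{i,j}-\mathrm{Att}^{(h_S)}_{i,j}|\le\gamma$ for all $i\in[n]$, $j\in[d]$.
   Context: $\mathrm{Att}^{(h_S)}\in\mathbb{R}^{n\times d}$ (Strassen-attention) is the matrix with $i$-th row $$\frac{\sum_{j,k\in[n]}\exp\big(\tfrac1d(\langle Q^{(1)}_i,Q^{(2)}_j\rangle+\langle Q^{(2)}_j,Q^{(3)}_k\rangle+\langle Q^{(3)}_k,Q^{(1)}_i\rangle)\big)\,V^{(2)}_j\odot V^{(3)}_k}{\sum_{j,k\in[n]}\exp\big(\tfrac1d(\langle Q^{(1)}_i,Q^{(2)}_j\rangle+\langle Q^{(2)}_j,Q^{(3)}_k\rangle+\langle Q^{(3)}_k,Q^{(1)}_i\rangle)\big)},$$ where subscripts denote rows, $\langle\cdot,\cdot\rangle$ is the usual inner product and $\odot$ is the entrywise product.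
   Formalization: The output is correct for all real value matrices, but the O(n^{1+o(1)}) time (on a real RAM with unit-cost field operations) is claimed only when the entries of V^(2), V^(3) are at most n^κ in absolute value, for any fixed κ; for unbounded entries no such time bound can hold in this model. *)

(* Defs.v *)
From mathcomp Require Import all_boot all_order all_algebra.
From mathcomp Require Import all_classical all_reals all_analysis.

Set Implicit Arguments.
Unset Strict Implicit.
Unset Printing Implicit Defensive.

Import Order.TTheory GRing.Theory Num.Theory.
Import numFieldNormedType.Exports.

Local Open Scope ring_scope.

(** * Strassen-attention *)

Definition row_dot (R : realType) (n d : nat) (A B : 'M[R]_(n, d))
    (i j : 'I_n) : R :=
  \sum_(l < d) A i l * B j l.

Definition strassen_weight (R : realType) (n d : nat)
    (Q1 Q2 Q3 : 'M[R]_(n, d)) (i j k : 'I_n) : R :=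
  expR (d%:R^-1 * (row_dot Q1 Q2 i j + row_dot Q2 Q3 j k + row_dot Q3 Q1 k i)).

Definition strassen_att (R : realType) (n d : nat)
    (Q1 Q2 Q3 V2 V3 : 'M[R]_(n, d)) : 'M[R]_(n, d) :=
  \matrix_(i < n, l < d)
    ((\sum_(j < n) \sum_(k < n)
        strassen_weight Q1 Q2 Q3 i j k * (V2 j l * V3 k l))
     / (\sum_(j < n) \sum_(k < n) strassen_weight Q1 Q2 Q3 i j k)).

(** * Real RAM

    Algorithms are programs of a structured real RAM, with a memory of
    countably many integer arrays and countably many real arrays, each indexed
    by [nat]; a scalar variable is the cell of index 0 of an array.  The
    primitives on reals are exact field operations and comparison, at unit
    cost.  There is no [exp] and no rounding of reals to integers, and the only
    constants are natural numbers.  Integer operations have logarithmic cost,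
    so that integers cannot be used to pack data. *)

Inductive iexp : Type :=
| IConst of nat
| ILoad of nat & iexp            (* array name, index *)
| IAdd of iexp & iexp
| ISub of iexp & iexp            (* truncated *)
| IMul of iexp & iexp
| IDiv of iexp & iexp
| IMod of iexp & iexp.

Inductive rexp : Type :=
| ROfInt of iexp
| RLoad of nat & iexp            (* array name, index *)
| RAdd of rexp & rexp
| RSub of rexp & rexp
| RMul of rexp & rexp
| RDiv of rexp & rexp.           (* x / 0 = 0 *)

Inductive bexp : Type :=
| BILt of iexp & iexp
| BRLt of rexp & rexp
| BNot of bexp
| BAnd of bexp & bexp.

Inductive cmd : Type :=
| Skip
| ISet of nat & iexp & iexp      (* array name, index, new value *)
| RSet of nat & iexp & rexp      (* array name, index, new value *)
| Seq of cmd & cmd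
| If of bexp & cmd & cmd
| While of bexp & cmd.

Record state (R : realType) := State {
  imem : nat -> nat -> nat;      (* array name, index *)
  rmem : nat -> nat -> R
}.

Definition upd (T : Type) (m : nat -> nat -> T) (a k : nat) (v : T) :
    nat -> nat -> T :=
  fun a' k' => if (a' == a) && (k' == k) then v else m a' k'.

Section Semantics.
Variable R : realType.
Implicit Types (s : state R) (e : iexp) (r : rexp) (b : bexp) (c : cmd).

Fixpoint ieval s e : nat :=
  match e with
  | IConst m => m
  | ILoad a e => imem s a (ieval s e)
  | IAdd e f => (ieval s e + ieval s f)%N
  | ISub e f => (ieval s e - ieval s f)%N
  | IMul e f => (ieval s e * ieval s f)%N
  | IDiv e f => (ieval s e %/ ieval s f)%N
  | IMod e f => (ieval s e %% ieval s f)%N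
  end.

Fixpoint reval s r : R :=
  match r with
  | ROfInt e => (ieval s e)%:R
  | RLoad a e => rmem s a (ieval s e)
  | RAdd p q => reval s p + reval s q
  | RSub p q => reval s p - reval s q
  | RMul p q => reval s p * reval s q
  | RDiv p q => reval s p / reval s q
  end.

Fixpoint beval s b : bool :=
  match b with
  | BILt e f => (ieval s e < ieval s f)%N
  | BRLt p q => reval s p < reval s q
  | BNot b => ~~ beval s b
  | BAnd b b' => beval s b && beval s b'
  end.

Definition bitlen (m : nat) : nat := (trunc_log 2 m).+1.

(* Every node of an integer expression is charged the bit length of its value,
   hence an operation is charged the bit lengths of its operands and result. *)
Fixpoint icost s e : nat :=
  (bitlen (ieval s e) +
   match e with
   | IConst _ => 0
   | ILoad _ e => icost s e
   | IAdd e f | ISub e f | IMul e f | IDiv e f | IMod e f =>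
       icost s e + icost s f
   end)%N.

Fixpoint rcost s r : nat :=
  match r with
  | ROfInt e | RLoad _ e => (icost s e).+1
  | RAdd p q | RSub p q | RMul p q | RDiv p q => (rcost s p + rcost s q).+1
  end.

Fixpoint bcost s b : nat :=
  match b with
  | BILt e f => (icost s e + icost s f).+1
  | BRLt p q => (rcost s p + rcost s q).+1
  | BNot b => (bcost s b).+1
  | BAnd b b' => (bcost s b + bcost s b').+1
  end.

(* [exec c s t s']: started in [s], the program [c] halts in [s'] after time
   [t].  A diverging run is related to nothing. *)
Inductive exec : cmd -> state R -> nat -> state R -> Prop :=
| ExecSkip s : exec Skip s 1 s
| ExecISet a e f s :
    exec (ISet a e f) s (icost s e + icost s f).+1
      (State (upd (imem s) a (ieval s e) (ieval s f)) (rmem s))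
| ExecRSet a e r s :
    exec (RSet a e r) s (icost s e + rcost s r).+1
      (State (imem s) (upd (rmem s) a (ieval s e) (reval s r)))
| ExecSeq c c' s s' s'' t t' :
    exec c s t s' -> exec c' s' t' s'' -> exec (Seq c c') s (t + t')%N s''
| ExecIf b c c' s s' t :
    exec (if beval s b then c else c') s t s' ->
    exec (If b c c') s ((bcost s b).+1 + t)%N s'
| ExecWhileF b c s :
    ~~ beval s b -> exec (While b c) s (bcost s b).+1 s
| ExecWhileT b c s s' s'' t t' :
    beval s b -> exec c s t s' -> exec (While b c) s' t' s'' ->
    exec (While b c) s ((bcost s b).+1 + t + t')%N s''.

Lemma exec_det c s t t' s1 s2 :
  exec c s t s1 -> exec c s t' s2 -> t = t' /\ s1 = s2.
Proof.
move=> h; elim: h t' s2 => {c s t s1}.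
- by move=> s t' s2 h; inversion h.
- by move=> a e f s t' s2 h; inversion h.
- by move=> a e r s t' s2 h; inversion h.
- move=> c c' s s' s'' t t' _ IH1 _ IH2 u s2 h.
  inversion h as [| | |? ? ? ? ? ? ? h1 h2| | |]; subst.
  have [? ?] := IH1 _ _ h1; subst.
  by have [? ?] := IH2 _ _ h2; subst.
- move=> b c c' s s' t _ IH u s2 h.
  inversion h as [| | | |? ? ? ? ? ? h1| |]; subst.
  by have [? ?] := IH _ _ h1; subst.
- move=> b c s /negbTE nb u s2 h.
  inversion h as [| | | | |? ? ? h1|? ? ? ? ? ? ? h1]; subst => //.
  by rewrite nb in h1.
- move=> b c s s' s'' t t' hb _ IH1 _ IH2 u s2 h.
  inversion h as [| | | | |? ? ? h1|? ? ? ? ? ? ? ? h1 h2]; subst.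
    by rewrite hb in h1.
  have [? ?] := IH1 _ _ h1; subst.
  by have [? ?] := IH2 _ _ h2; subst.
Qed.

(** * Input and output conventions *)

(* Row-major layout, with 0 outside of the matrix. *)
Definition mx_cells (n d : nat) (M : 'M[R]_(n, d)) (k : nat) : R :=
  if insub (k %/ d)%N is Some i then
    if insub (k %% d)%N is Some j then M i j else 0
  else 0.

(* Integer cells 0[0] and 0[1] hold n and d, real cells 0[0] and 0[1] hold
   [Gamma] and [gamma], and the real arrays 1, ..., 5 hold the matrices; all
   other cells are 0. *)
Definition input (n d : nat) (Gamma gamma : R)
    (Q1 Q2 Q3 V2 V3 : 'M[R]_(n, d)) : state R :=
  State
    (fun a k => if a == 0%N then nth 0%N [:: n; d] k else 0%N)
    (fun a k => match a with
       | 0 => nth 0 [:: Gamma; gamma] k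
       | 1 => mx_cells Q1 k
       | 2 => mx_cells Q2 k
       | 3 => mx_cells Q3 k
       | 4 => mx_cells V2 k
       | 5 => mx_cells V3 k
       | _ => 0
       end).

(* The result is read, row-major, in the real array 6. *)
Definition output (n d : nat) (s : state R) : 'M[R]_(n, d) :=
  \matrix_(i < n, j < d) rmem s 6 (i * d + j)%N.

Definition entries_le (n d : nat) (B : R) (M : 'M[R]_(n, d)) : Prop :=
  forall i j, `|M i j| <= B.

End Semantics.

(* Main.v *)
Require Import Defs.
From mathcomp Require Import all_boot all_order all_algebra.
From mathcomp Require Import all_classical all_reals all_analysis.
From mathcomp Require Import zify ring lra.

Set Implicit Arguments.
Unset Strict Implicit.
Unset Printing Implicit Defensive.

Import Order.TTheory GRing.Theory Num.Theory.
Import numFieldNormedType.Exports.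

Local Open Scope classical_set_scope.
Local Open Scope ring_scope.

(** The exponent is a trilinear form in the rows [x = Q1_i], [y = Q2_j],
    [z = Q3_k]: it is [1/d] times the sum of the [3d] products [x_l y_l],
    [y_l z_l], [z_l x_l].  Truncating the exponential series at degree [G] and
    expanding by the multinomial formula turns the weight into a sum over the
    multi-indices [alpha] in [N^(3d)] with [|alpha| <= G] of
    [c_alpha * m1_alpha (x) * m2_alpha (y) * m3_alpha (z)], so each
    [alpha] contributes to all numerators and denominators in time [n] times a
    polynomial in [d] and [G].  As [|exponent| <= B = 3 Gamma^2]
    with [B = o(log n)], a relative error [1 / poly n] is reached for some
    [G = o(log n)]: [B^k / k! <= exp (B e^z - z k)] for every [z].  The number
    of multi-indices is then at most [x^(-G) (1 - x)^(-3d)] for every [x] in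
    [(0,1)], hence [n^o(1)] since [d = O(log n)]. *)

(** * Running time on the real RAM *)

(** One program has to serve all [d], [Gamma] and [gamma], on a machine with neither [exp] nor
    rounding, so the truncation degree is searched for at run time: the program counts up to
    [N = ceil B], uses [16 ^ N] in place of [exp (2 B)], and raises [G] until
    [C * B ^ (G+1) / (G+1)!] is at most 1. The factor [exp (2 B)] is the price of a relative error:
    the Taylor remainder carries [exp B], and a weight may be as small as [exp (- B)]. A relative
    error is what a quotient of two approximated sums tolerates. As [C] contains the squares of the
    values, the degree reached depends on [V2] and [V3]. The output is right whatever it is; for the
    running time it is compared with the degree [G n] belonging to the largest values that
    [n ^ kappa] allows. Without recursion, multi-indices are enumerated by an in-place successor.
    The recursive list [multi], suited to summing and counting, is shown to be the orbit of that
    successor. *)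

Fixpoint modi (c : cmd) : seq nat :=
  match c with
  | Skip | RSet _ _ _ => [::]
  | ISet a _ _ => [:: a]
  | Seq c c' | If _ c c' => modi c ++ modi c'
  | While _ c => modi c
  end.

Fixpoint modr (c : cmd) : seq nat :=
  match c with
  | Skip | ISet _ _ _ => [::]
  | RSet a _ _ => [:: a]
  | Seq c c' | If _ c c' => modr c ++ modr c'
  | While _ c => modr c
  end.

(** When cells and constants are at most [M] and [M >= 2], the value of [e] is at most
    [M ^ ileaves e], a load being one leaf whatever its index. So [ileaves] bounds the bit length in
    units of [bitlen M], and [iweight] adds this up over all nodes in parallel with [icost]. *)
Fixpoint ileaves (e : iexp) : nat :=
  match e with
  | IConst _ | ILoad _ _ => 1
  | IAdd e f | ISub e f | IMul e f | IDiv e f | IMod e f => ileaves e + ileaves f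
  end.

Fixpoint iweight (e : iexp) : nat :=
  (ileaves e +
   match e with
   | IConst _ => 0
   | ILoad _ e => iweight e
   | IAdd e f | ISub e f | IMul e f | IDiv e f | IMod e f => iweight e + iweight f
   end)%N.

Fixpoint rweight (r : rexp) : nat :=
  match r with
  | ROfInt e | RLoad _ e => (iweight e).+1
  | RAdd p q | RSub p q | RMul p q | RDiv p q => (rweight p + rweight q).+1
  end.

Fixpoint bweight (b : bexp) : nat :=
  match b with
  | BILt e f => (iweight e + iweight f).+1
  | BRLt p q => (rweight p + rweight q).+1
  | BNot b => (bweight b).+1
  | BAnd b b' => (bweight b + bweight b').+1
  end.

Fixpoint cweight (c : cmd) : nat :=
  match c with
  | Skip => 1
  | ISet _ e f => (iweight e + iweight f).+1
  | RSet _ e r => (iweight e + rweight r).+1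
  | Seq c c' => (cweight c + cweight c')%N
  | If b c c' => ((bweight b).+1 + (cweight c + cweight c'))%N
  | While b c => ((bweight b).+1 + cweight c)%N
  end.

Fixpoint iconsts (e : iexp) : seq nat :=
  match e with
  | IConst m => [:: m]
  | ILoad _ e => iconsts e
  | IAdd e f | ISub e f | IMul e f | IDiv e f | IMod e f => iconsts e ++ iconsts f
  end.

Fixpoint rconsts (r : rexp) : seq nat :=
  match r with
  | ROfInt e | RLoad _ e => iconsts e
  | RAdd p q | RSub p q | RMul p q | RDiv p q => rconsts p ++ rconsts q
  end.

Fixpoint bconsts (b : bexp) : seq nat :=
  match b with
  | BILt e f => iconsts e ++ iconsts f
  | BRLt p q => rconsts p ++ rconsts q
  | BNot b => bconsts b
  | BAnd b b' => bconsts b ++ bconsts b'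
  end.

Fixpoint cconsts (c : cmd) : seq nat :=
  match c with
  | Skip => [::]
  | ISet _ e f => iconsts e ++ iconsts f
  | RSet _ e r => iconsts e ++ rconsts r
  | Seq c c' => cconsts c ++ cconsts c'
  | If b c c' => bconsts b ++ cconsts c ++ cconsts c'
  | While b c => bconsts b ++ cconsts c
  end.

(* The value of such an expression exceeds every memory cell and every
   constant by at most 1. *)
Fixpoint slow (e : iexp) : bool :=
  match e with
  | IConst _ | ILoad _ _ => true
  | IAdd (ILoad _ _) (IConst 1) => true
  | ISub (ILoad _ _) _ => true
  | _ => false
  end.

Fixpoint cslow (c : cmd) : bool :=
  match c with
  | Skip | RSet _ _ _ => true
  | ISet _ _ f => slow f
  | Seq c c' | If _ c c' => cslow c && cslow c'
  | While _ c => cslow c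
  end.

Definition iv (a : nat) := ILoad a (IConst 0).
Definition rv (a : nat) := RLoad a (IConst 0).

Definition For (v : nat) e c :=
  Seq (ISet v (IConst 0) (IConst 0))
    (While (BILt (iv v) e) (Seq c (ISet v (IConst 0) (IAdd (iv v) (IConst 1))))).

(** Each pass adds a test and an increment to the body; the last 2 is the initialisation and the
    failing test. *)
Definition for_time m U := (m * (U + 2) + 2)%N.

(** * Unit-cost execution, its logarithmic cost, and a program logic that counts steps *)

Section Logic.
Variable R : realType.
Implicit Types (s : state R) (e : iexp) (r : rexp) (b : bexp) (c : cmd).

(* Execution at unit cost per command.  In a program whose assigned integers
   are [slow], the integers in memory grow by at most 1 per step, so [run]
   determines the logarithmic cost up to a factor [bitlen (M + steps)]; see
   [run_exec]. *)
Inductive run : cmd -> state R -> nat -> state R -> Prop :=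
| RunSkip s : run Skip s 1 s
| RunISet a e f s :
    run (ISet a e f) s 1 (State (upd (imem s) a (ieval s e) (ieval s f)) (rmem s))
| RunRSet a e r s :
    run (RSet a e r) s 1 (State (imem s) (upd (rmem s) a (ieval s e) (reval s r)))
| RunSeq c c' s s' s'' t t' :
    run c s t s' -> run c' s' t' s'' -> run (Seq c c') s (t + t')%N s''
| RunIf b c c' s s' t :
    run (if beval s b then c else c') s t s' -> run (If b c c') s t.+1 s'
| RunWhileF b c s : ~~ beval s b -> run (While b c) s 1 s
| RunWhileT b c s s' s'' t t' :
    beval s b -> run c s t s' -> run (While b c) s' t' s'' ->
    run (While b c) s (1 + t + t')%N s''.

Lemma bitlen_leq m n : (m <= n)%N -> (bitlen m <= bitlen n)%N.
Proof. by move=> mn; rewrite ltnS leq_trunc_log. Qed.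

Lemma bitlen_ltn m : (m < 2 ^ bitlen m)%N.
Proof. exact: trunc_log_ltn. Qed.

Lemma bitlen_expn M a m : (0 < a)%N -> (m <= M ^ a)%N ->
  (bitlen m <= a * bitlen M)%N.
Proof.
move=> a0 mMa; case: m mMa => [|m] mMa.
  by rewrite /bitlen trunc_log0 muln_gt0 a0.
rewrite -(@ltn_exp2l 2)//; apply: leq_ltn_trans (trunc_logP _ _) _ => //.
apply: leq_ltn_trans mMa _.
by rewrite mulnC expnM ltn_exp2r// bitlen_ltn.
Qed.

Lemma leaves_gt0 e : (0 < ileaves e)%N.
Proof. by elim: e => //= e He f Hf; rewrite addn_gt0 He. Qed.

Definition ibounded M s := forall a k, (imem s a k <= M)%N.

Lemma ieval_leaves M s e : (1 < M)%N -> ibounded M s ->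
  all (leq^~ M) (iconsts e) -> (ieval s e <= M ^ ileaves e)%N.
Proof.
move=> M1 sM; have M0 := ltnW M1.
have mono x y : (x <= M ^ ileaves y)%N -> forall z, (x <= M ^ (ileaves y + ileaves z))%N.
  by move=> h z; apply: leq_trans h _; rewrite leq_pexp2l// leq_addr.
elim: e => //=.
- by move=> m; rewrite andbT expn1.
- move=> e He f Hf; rewrite all_cat => /andP[/He {}He /Hf {}Hf].
  apply: leq_trans (leq_add He Hf) _; rewrite expnD.
  have h x : (1 < M ^ ileaves x)%N.
    by rewrite -(exp1n (ileaves x)) ltn_exp2r// leaves_gt0.
  by move: (h e) (h f); nia.
- move=> e He f _; rewrite all_cat => /andP[/He {}He _].
  by apply: mono; apply: leq_trans He; apply: leq_subr.
- move=> e He f Hf; rewrite all_cat => /andP[/He {}He /Hf {}Hf].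
  by rewrite expnD leq_mul.
- move=> e He f _; rewrite all_cat => /andP[/He {}He _].
  by apply: mono; apply: leq_trans He; apply: leq_div.
- move=> e He f _; rewrite all_cat => /andP[/He {}He _].
  by apply: mono; apply: leq_trans He; apply: leq_mod.
Qed.

Lemma icost_le M s e : (1 < M)%N -> ibounded M s ->
  all (leq^~ M) (iconsts e) -> (icost s e <= iweight e * bitlen M)%N.
Proof.
move=> M1 sM.
have key x : all (leq^~ M) (iconsts x) ->
    (bitlen (ieval s x) <= ileaves x * bitlen M)%N.
  by move=> ?; apply: bitlen_expn (leaves_gt0 _) _; apply: ieval_leaves.
elim: e => [m|a e He|e He f Hf|e He f Hf|e He f Hf|e He f Hf|e He f Hf] h;
  rewrite [icost _ _]/= [iweight _]/= mulnDl leq_add ?(key _ h)//.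
1: by apply: He.
all: by move: h; rewrite /= all_cat mulnDl => /andP[/He ? /Hf ?]; rewrite leq_add.
Qed.

Lemma bitlen_gt0 m : (0 < bitlen m)%N. Proof. by []. Qed.

Lemma rcost_le M s r : (1 < M)%N -> ibounded M s ->
  all (leq^~ M) (rconsts r) -> (rcost s r <= rweight r * bitlen M)%N.
Proof.
move=> M1 sM; have L := bitlen_gt0 M.
elim: r => [e|a e|p Hp q Hq|p Hp q Hq|p Hp q Hq|p Hp q Hq] /=.
1,2: by move=> /(icost_le M1 sM) h; rewrite mulSn -add1n leq_add.
all: rewrite all_cat => /andP[/Hp ? /Hq ?].
all: by rewrite mulSn mulnDl -add1n leq_add// leq_add.
Qed.

Lemma bcost_le M s b : (1 < M)%N -> ibounded M s ->
  all (leq^~ M) (bconsts b) -> (bcost s b <= bweight b * bitlen M)%N.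
Proof.
move=> M1 sM; have L := bitlen_gt0 M.
elim: b => [e f|p q|b Hb|b Hb b' Hb'] /=; rewrite ?all_cat.
- by move=> /andP[/(icost_le M1 sM) ? /(icost_le M1 sM) ?];
    rewrite mulSn mulnDl -add1n leq_add// leq_add.
- by move=> /andP[/(rcost_le M1 sM) ? /(rcost_le M1 sM) ?];
    rewrite mulSn mulnDl -add1n leq_add// leq_add.
- by move=> /Hb ?; rewrite mulSn -add1n leq_add.
- by move=> /andP[/Hb ? /Hb' ?]; rewrite mulSn mulnDl -add1n leq_add// leq_add.
Qed.

Lemma ieval_slow M s e : ibounded M s -> all (leq^~ M) (iconsts e) -> slow e ->
  (ieval s e <= M.+1)%N.
Proof.
move=> sM; case: e => //=.
- by move=> m /andP[/leqW].
- by move=> a e _ _; apply: leqW.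
- move=> [m|a e|? ?|? ?|? ?|? ?|? ?] [n|? ?|? ?|? ?|? ?|? ?|? ?] //=.
  by case: n => [|[|n]]//= _ _; rewrite addn1 ltnS.
- move=> [m|a e|? ?|? ?|? ?|? ?|? ?] f //= _ _.
  by apply: leqW; apply: leq_trans (leq_subr _ _) _.
Qed.

(** Along the run all integers stay below [M + u], so each unit step, which evaluates the
    expressions of one node of [c], costs at most [cweight c * bitlen (M + u)]. The weight of a loop
    takes its body once, because [u] already counts the passes. *)
Lemma run_exec c s u s' M : run c s u s' -> (1 < M)%N -> ibounded M s ->
  cslow c -> all (leq^~ M) (cconsts c) ->
  ibounded (M + u) s' /\
  exists2 t, exec c s t s' & (t <= u * (cweight c * bitlen (M + u)))%N.
Proof.
move=> h; elim: h M => {c s u s'}.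
- move=> s M M1 sM _ _; split; first by move=> a k; rewrite (leq_trans (sM a k))// leq_addr.
  by exists 1%N; [exact: ExecSkip | rewrite !mul1n].
- move=> a e f s M M1 sM /= fs; rewrite all_cat => /andP[he hf]; split.
    move=> a' k'; rewrite /= /upd; case: ifP => _; last by rewrite (leq_trans (sM _ _))// leq_addr.
    by rewrite addn1 ieval_slow.
  exists (icost s e + icost s f).+1; first exact: ExecISet.
  rewrite mul1n; apply: (@leq_trans ((iweight e + iweight f).+1 * bitlen M)); last first.
    by rewrite leq_mul// bitlen_leq// leq_addr.
  by rewrite mulSn mulnDl -add1n leq_add// leq_add ?icost_le.
- move=> a e r s M M1 sM /= fs; rewrite all_cat => /andP[he hf]; split.
    by move=> a' k'; rewrite /= (leq_trans (sM _ _))// leq_addr.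
  exists (icost s e + rcost s r).+1; first exact: ExecRSet.
  rewrite mul1n; apply: (@leq_trans ((iweight e + rweight r).+1 * bitlen M)); last first.
    by rewrite leq_mul// bitlen_leq// leq_addr.
  by rewrite mulSn mulnDl -add1n leq_add// leq_add ?icost_le ?rcost_le.
- move=> c c' s s' s'' u u' _ IH1 _ IH2 M M1 sM /= /andP[c1 c2].
  rewrite all_cat => /andP[k1 k2].
  have [sM' [t e1 le1]] := IH1 _ M1 sM c1 k1.
  have M1' : (1 < M + u)%N by rewrite (leq_trans M1)// leq_addr.
  have k2' : all (leq^~ (M + u)%N) (cconsts c').
    by apply: sub_all k2 => x /leq_trans; apply; rewrite leq_addr.
  have [sM'' [t' e2 le2]] := IH2 _ M1' sM' c2 k2'.
  rewrite addnA; split=> //; exists (t + t')%N; first exact: ExecSeq e1 e2.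
  have := @bitlen_leq (M + u) (M + u + u') (leq_addr _ _).
  move: le1 le2; set b1 := bitlen _; set b2 := bitlen _ => le1 le2 le3.
  rewrite mulnDl leq_add//.
    by apply: leq_trans le1 _; rewrite leq_mul// leq_mul// leq_addr.
  by apply: leq_trans le2 _; rewrite leq_mul// leq_mul// leq_addl.
- move=> b c c' s s' u _ IH M M1 sM /= /andP[c1 c2].
  rewrite !all_cat => /and3P[kb k1 k2].
  have cs : cslow (if beval s b then c else c') by case: ifP.
  have ks : all (leq^~ M) (cconsts (if beval s b then c else c')) by case: ifP.
  have [sM' [t e1 le1]] := IH _ M1 sM cs ks.
  rewrite addnS; split; first by move=> a k; rewrite (leq_trans (sM' a k)).
  exists ((bcost s b).+1 + t)%N; first exact: ExecIf.
  have hb := bcost_le M1 sM kb.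
  have l1 := @bitlen_leq M (M + u).+1 (leqW (leq_addr _ _)).
  have l2 := @bitlen_leq (M + u) (M + u).+1 (leqnSn _).
  rewrite mulSn leq_add//.
    apply: (@leq_trans ((bweight b).+1 * bitlen (M + u).+1)).
      by rewrite mulSn -add1n leq_add// (leq_trans hb)// leq_mul.
    by rewrite leq_mul// leq_addr.
  apply: leq_trans le1 _; rewrite leq_mul// leq_mul//.
  case: ifP => _; first by rewrite addnCA leq_addr.
  by rewrite addnA leq_addl.
- move=> b c s nb M M1 sM /= cs; rewrite all_cat => /andP[kb kc]; split.
    by move=> a k; rewrite (leq_trans (sM a k))// leq_addr.
  exists (bcost s b).+1; first exact: ExecWhileF.
  have hb := bcost_le M1 sM kb.
  have l1 := @bitlen_leq M (M + 1) (leq_addr _ _).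
  rewrite mul1n; apply: (@leq_trans ((bweight b).+1 * bitlen (M + 1))).
    by rewrite mulSn -add1n leq_add// (leq_trans hb)// leq_mul.
  by rewrite leq_mul// leq_addr.
- move=> b c s s' s'' u u' hb _ IH1 _ IH2 M M1 sM cs ks.
  have /= := ks; rewrite all_cat => /andP[kb kc].
  have [sM' [t e1 le1]] := IH1 _ M1 sM cs kc.
  have M1' : (1 < M + u)%N by rewrite (leq_trans M1)// leq_addr.
  have ks' : all (leq^~ (M + u)%N) (cconsts (While b c)).
    by apply: sub_all ks => x /leq_trans; apply; rewrite leq_addr.
  have [sM'' [t' e2 le2]] := IH2 _ M1' sM' cs ks'.
  split; first by move=> a k; rewrite (leq_trans (sM'' a k))//; lia.
  exists ((bcost s b).+1 + t + t')%N; first exact: ExecWhileT e1 e2.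
  have := bcost_le M1 sM kb.
  have l0 : (M <= M + (1 + u + u'))%N by lia.
  have l1 : (M + u <= M + (1 + u + u'))%N by lia.
  have l2 : (M + u + u' <= M + (1 + u + u'))%N by lia.
  move: le1 le2 (bitlen_leq l0) (bitlen_leq l1) (bitlen_leq l2) => /=.
  move: (bitlen_gt0 (M + (1 + u + u'))).
  set z := bitlen (M + _); set z0 := bitlen M; set z1 := bitlen _; set z2 := bitlen _.
  move=> zp le1 le2 m0 m1 m2 le0.
  have {}le0 : (bcost s b <= bweight b * z)%N by apply: leq_trans le0 _; rewrite leq_mul.
  have {}le1 : (t <= u * (cweight c * z))%N.
    by apply: leq_trans le1 _; rewrite leq_mul// leq_mul.
  have {}le2 : (t' <= u' * (((bweight b).+1 + cweight c) * z))%N.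
    by apply: leq_trans le2 _; rewrite leq_mul// leq_mul.
  have {}le0 : ((bcost s b).+1 <= ((bweight b).+1 + cweight c) * z)%N.
    by rewrite mulnDl mulSn; lia.
  have {}le1 : (t <= u * (((bweight b).+1 + cweight c) * z))%N.
    by apply: leq_trans le1 _; rewrite leq_mul// leq_mul// leq_addl.
  by move: le0 le1 le2; set W := (_ * z)%N; rewrite !mulnDl mul1n; lia.
Qed.

(** Frame condition: array names are static, so what a command may write is read off its syntax.
    Postconditions can then mention only what changes. *)
Definition same c s s' :=
  (forall a, a \notin modi c -> imem s' a = imem s a) /\
  (forall a, a \notin modr c -> rmem s' a = rmem s a).

Lemma same_refl c s : same c s s. Proof. by []. Qed.

Lemma same_trans c s1 s2 s3 : same c s1 s2 -> same c s2 s3 -> same c s1 s3.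
Proof.
move=> [i1 r1] [i2 r2]; split=> a ha; first by rewrite i2// i1.
by rewrite r2// r1.
Qed.

Lemma same_sub c c' s s' : {subset modi c <= modi c'} -> {subset modr c <= modr c'} ->
  same c s s' -> same c' s s'.
Proof.
move=> si sr [i1 r1]; split=> a ha; [apply: i1|apply: r1]; apply: contra ha.
  exact: si.
exact: sr.
Qed.

Lemma upd_neq (T : Type) (m : nat -> nat -> T) a k v a' :
  a' != a -> upd m a k v a' = m a'.
Proof. by move=> /negbTE h; apply/funext => k'; rewrite /upd h. Qed.

Lemma run_same c s u s' : run c s u s' -> same c s s'.
Proof.
elim=> {c s u s'}.
- by move=> s; apply: same_refl.
- by move=> a e f s; split=> //= a'; rewrite inE; apply: upd_neq.
- by move=> a e f s; split=> //= a'; rewrite inE; apply: upd_neq.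
- move=> c c' s s' s'' _ _ _ h1 _ h2; apply: same_trans (same_sub _ _ h1) (same_sub _ _ h2);
  by move=> x /=; rewrite mem_cat => ->; rewrite ?orbT.
- move=> b c c' s s' _ _; apply: same_sub => x /=; rewrite mem_cat;
  by case: ifP => _ ->; rewrite ?orbT.
- by move=> b c s _; apply: same_refl.
- by move=> b c s s' s'' _ _ _ _ h1 _ h2; apply: same_trans h1 h2.
Qed.

Lemma same_i c s s' a : same c s s' -> a \notin modi c -> imem s' a = imem s a.
Proof. by case=> h _; apply: h. Qed.

Lemma same_r c s s' a : same c s s' -> a \notin modr c -> rmem s' a = rmem s a.
Proof. by case=> _ h; apply: h. Qed.

(** A total-correctness triple with a step budget. The budget is only an upper bound, so that loops
    with data-dependent length can be charged uniformly. *)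
Definition runs c s U (Q : state R -> Prop) :=
  exists u s', [/\ run c s u s', (u <= U)%N & Q s'].

Lemma runs_weak c s U U' (Q Q' : state R -> Prop) : runs c s U Q -> (U <= U')%N ->
  (forall s', Q s' -> same c s s' -> Q' s') -> runs c s U' Q'.
Proof.
move=> [u [s' [h hu q]]] UU' QQ'; exists u, s'; split=> //; first exact: leq_trans UU'.
by apply: QQ' => //; apply: run_same h.
Qed.

Lemma runs_iset a e f s (Q : state R -> Prop) :
  Q (State (upd (imem s) a (ieval s e) (ieval s f)) (rmem s)) ->
  runs (ISet a e f) s 1 Q.
Proof. by move=> q; do 2 eexists; split; first exact: RunISet. Qed.

Lemma runs_rset a e r s (Q : state R -> Prop) :
  Q (State (imem s) (upd (rmem s) a (ieval s e) (reval s r))) ->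
  runs (RSet a e r) s 1 Q.
Proof. by move=> q; do 2 eexists; split; first exact: RunRSet. Qed.

Lemma runs_seq (P : state R -> Prop) c c' s U U' (Q : state R -> Prop) :
  runs c s U P ->
  (forall s', P s' -> same c s s' -> runs c' s' U' Q) ->
  runs (Seq c c') s (U + U') Q.
Proof.
move=> [u [s' [h hu p]]] H.
have [u' [s'' [h' hu' q]]] := H _ p (run_same h).
by exists (u + u')%N, s''; split=> //; [exact: RunSeq h h'|rewrite leq_add].
Qed.

Lemma runs_if b c c' s U (Q : state R -> Prop) :
  runs (if beval s b then c else c') s U Q -> runs (If b c c') s U.+1 Q.
Proof. by move=> [u [s' [h hu q]]]; exists u.+1, s'; split=> //; exact: RunIf. Qed.

Lemma runs_whileF b c s (Q : state R -> Prop) :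
  ~~ beval s b -> Q s -> runs (While b c) s 1 Q.
Proof. by move=> nb q; exists 1%N, s; split=> //; exact: RunWhileF. Qed.

Lemma runs_whileT b c s U U' (Q : state R -> Prop) :
  beval s b -> runs c s U (fun s' => same c s s' -> runs (While b c) s' U' Q) ->
  runs (While b c) s (1 + U + U') Q.
Proof.
move=> hb [u [s' [h hu /(_ (run_same h))]]] [u' [s'' [h' hu' q]]].
exists (1 + u + u')%N, s''; split=> //; first exact: RunWhileT hb h h'.
by rewrite !leq_add.
Qed.

Definition seti s v k := State (upd (imem s) v 0 k) (rmem s).

(** The bound [e] is re-evaluated at every test, hence its stability under the frame. The invariant
    is required after [seti], because the increment follows the body. The exact count [m] is kept
    apart from [mb] since inner loops run as often as an exponent says, while the time is to depend
    only on the degree bound. *)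
Lemma runs_for (I : nat -> state R -> Prop) v e c s m mb U :
  v \notin modi c -> (m <= mb)%N ->
  (forall s', same (For v e c) s s' -> ieval s' e = m) ->
  I 0%N (seti s v 0) ->
  (forall k s', (k < m)%N -> same (For v e c) s s' -> I k s' -> imem s' v 0 = k ->
     runs c s' U (fun s'' => same c s' s'' -> I k.+1 (seti s'' v k.+1))) ->
  runs (For v e c) s (for_time mb U) (I m).
Proof.
move=> vc mmb em I0 step; set F := For v e c.
pose W := While (BILt (iv v) e) (Seq c (ISet v (IConst 0) (IAdd (iv v) (IConst 1)))).
have loop n : forall k s', (k + n)%N = m -> same F s s' -> I k s' -> imem s' v 0 = k ->
    runs W s' (n * (U + 2) + 1) (I m).
  elim: n => [|n IH] k s' kn ss Ik vk.
    rewrite addn0 in kn; apply: runs_whileF; last by rewrite -kn.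
    by rewrite /= em// vk kn ltnn.
  have km : (k < m)%N by rewrite -kn; lia.
  rewrite (_ : (n.+1 * (U + 2) + 1 = 1 + (U + 1) + (n * (U + 2) + 1))%N); last by lia.
  apply: runs_whileT; first by rewrite /= em// vk.
  apply: runs_seq (step _ _ km ss Ik vk) _ => s1 I1 ss1.
  apply: runs_iset => ss2; rewrite /= (same_i ss1 vc) vk addn1.
  apply: (IH k.+1); first by rewrite addSnnS.
  - apply: same_trans ss _; apply: same_trans (same_sub _ _ ss1) _.
    + by move=> x hx; rewrite /= !inE mem_cat hx orbT.
    + by move=> x hx; rewrite /= mem_cat hx.
    split=> // a /=; rewrite !inE negb_or => /andP[h _]; exact: upd_neq.
  - exact: I1.
  - by rewrite /= /upd !eqxx.
apply: (@runs_weak _ _ (1 + (m * (U + 2) + 1)) _ (I m)); last 2 first.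
- by rewrite /for_time addnCA leq_add// leq_mul.
- by [].
apply: (@runs_seq (fun s' => s' = seti s v 0)); first exact: runs_iset.
move=> _ -> _; apply: (loop _ 0%N) => //; last by rewrite /= /upd !eqxx.
by split=> // a /=; rewrite !inE negb_or => /andP[h _]; apply: upd_neq.
Qed.

End Logic.

(** * The program *)

Definition nE := ILoad 0 (IConst 0).
Definition dE := ILoad 0 (IConst 1).
Definition DE := IMul (IConst 3) dE.

(* Memory map, after the input arrays.  Integers: 1 truncation degree [G],
   2 current multi-index [alpha], 3 its degree, 4 stop flag, 5-10 counters.
   Reals: 6 numerators (the output), 7 denominators, 8 [B = 3 Gamma^2],
   9 [ceil B], 10 a bound on [exp (2 B)], 11 a bound on the products of values,
   12 the error estimate, 13 the coefficient of [alpha], 14-16 the monomials in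
   rows of Q2, Q3 and Q1, 17 and 18 the sums over the rows of Q2 and Q3. *)

(* [alpha] consists of three blocks of length [d], the exponents of the products
   Q1_l Q2_l, Q2_l Q3_l and Q3_l Q1_l; hence the pairs of block numbers 0 2, 0 1
   and 1 2 that select the exponents of Q1_l, Q2_l and Q3_l. *)
Definition exponent (o l : iexp) := ILoad 2 (IAdd l (IMul o dE)).

Definition mono_cmd (p a o1 o2 : nat) :=
  Seq (RSet p (IConst 0) (ROfInt (IConst 1)))
    (For 7 dE
      (For 8 (IAdd (exponent (IConst o1) (iv 7)) (exponent (IConst o2) (iv 7)))
        (RSet p (IConst 0)
          (RMul (rv p) (RLoad a (IAdd (IMul (iv 6) dE) (iv 7))))))).

Definition radd (p : nat) e := RSet p (IConst 0) (RAdd (rv p) e).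

(** [e2] and [e3] are the factors attached to the current row: entries of [V2] and [V3] for a
    numerator, 1 for a denominator. *)
Definition sums_cmd e2 e3 :=
  Seq (RSet 17 (IConst 0) (ROfInt (IConst 0)))
  (Seq (RSet 18 (IConst 0) (ROfInt (IConst 0)))
    (For 6 nE
      (Seq (mono_cmd 14 2 0 1)
      (Seq (mono_cmd 15 3 1 2)
      (Seq (radd 17 (RMul (rv 14) e2))
        (radd 18 (RMul (rv 15) e3))))))).

Definition cellE := IAdd (IMul (iv 6) dE) (iv 5).

Definition scatter_cmd (arr : nat) :=
  For 6 nE
    (Seq (mono_cmd 16 1 0 2)
      (RSet arr cellE
        (RAdd (RLoad arr cellE)
          (RMul (RMul (RMul (rv 13) (rv 16)) (rv 17)) (rv 18))))).

(** The denominator is the same in every column; accumulating it cell by cell at most doubles the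
    work and lets the final division run over a flat array. *)
Definition column_cmd :=
  Seq (Seq (sums_cmd (RLoad 4 cellE) (RLoad 5 cellE)) (scatter_cmd 6))
    (Seq (sums_cmd (ROfInt (IConst 1)) (ROfInt (IConst 1))) (scatter_cmd 7)).

(** The product of [d^-a / a!] over the entries [a] of the multi-index: the multinomial coefficient
    divided by the factorial of the degree, times the power of [1/d]. Dividing reals step by step
    avoids factorials as integers. *)
Definition coef_cmd :=
  Seq (RSet 13 (IConst 0) (ROfInt (IConst 1)))
    (For 7 DE
      (For 8 (ILoad 2 (iv 7))
        (RSet 13 (IConst 0)
          (RDiv (rv 13) (ROfInt (IMul dE (IAdd (iv 8) (IConst 1)))))))).

Definition term_cmd := Seq coef_cmd (For 5 dE column_cmd).

(** The degree in cell 3 is kept up to date, so that testing whether an entry can be raised needs no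
    summation. Here the degree is full, and entries are cleared from the left until there is
    room. *)
Definition carry_cmd :=
  While (BAnd (BILt (iv 10) DE) (BNot (BILt (iv 3) (iv 1))))
    (Seq (ISet 3 (IConst 0) (ISub (iv 3) (ILoad 2 (iv 10))))
    (Seq (ISet 2 (iv 10) (IConst 0))
      (ISet 10 (IConst 0) (IAdd (iv 10) (IConst 1))))).

Definition incr_cmd :=
  If (BILt (iv 10) DE)
    (Seq (ISet 2 (iv 10) (IAdd (ILoad 2 (iv 10)) (IConst 1)))
      (ISet 3 (IConst 0) (IAdd (iv 3) (IConst 1))))
    (ISet 4 (IConst 0) (IConst 1)).

Definition next_cmd :=
  Seq (ISet 10 (IConst 0) (IConst 0)) (Seq carry_cmd incr_cmd).

Definition main_loop := While (BILt (iv 4) (IConst 1)) (Seq term_cmd next_cmd).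

Definition divide_cmd :=
  For 9 (IMul nE dE) (RSet 6 (iv 9) (RDiv (RLoad 6 (iv 9)) (RLoad 7 (iv 9)))).

(** Counting 9 up to [ceil B] multiplies 10 by 16 each time; [16 ^ N >= exp (2 B)] because
    [exp 1 <= 4]. *)
Definition exp_bound_cmd :=
  Seq (RSet 8 (IConst 0)
        (RMul (RMul (ROfInt (IConst 3)) (RLoad 0 (IConst 0))) (RLoad 0 (IConst 0))))
  (Seq (RSet 10 (IConst 0) (ROfInt (IConst 1)))
    (While (BRLt (rv 9) (rv 8))
      (Seq (radd 9 (ROfInt (IConst 1)))
        (RSet 10 (IConst 0) (RMul (rv 10) (ROfInt (IConst 16))))))).

(** Squares bound every product [V2 * V3] by the arithmetic-geometric inequality, without absolute
    values; starting at 1 keeps the bound at least 1. *)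
Definition value_bound_cmd :=
  Seq (RSet 11 (IConst 0) (ROfInt (IConst 1)))
    (For 9 (IMul nE dE)
      (Seq (radd 11 (RMul (RLoad 4 (iv 9)) (RLoad 4 (iv 9))))
        (radd 11 (RMul (RLoad 5 (iv 9)) (RLoad 5 (iv 9)))))).

(** Cell 12 always holds [error_bound C B G], starting from [C * B] at [G = 0]; passing to the next
    degree multiplies it by [B / (G + 1)] for the new [G]. The 4 comes from
    [weighted_mean_perturb]. *)
Definition degree_cmd :=
  Seq (RSet 12 (IConst 0)
        (RMul (RMul (RMul (RMul (ROfInt (IConst 4)) (rv 11)) (rv 10))
          (RAdd (ROfInt (IConst 1)) (RDiv (ROfInt (IConst 1)) (RLoad 0 (IConst 1)))))
          (rv 8)))
    (While (BRLt (ROfInt (IConst 1)) (rv 12))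
      (Seq (ISet 1 (IConst 0) (IAdd (iv 1) (IConst 1)))
        (RSet 12 (IConst 0)
          (RDiv (RMul (rv 12) (rv 8)) (ROfInt (IAdd (iv 1) (IConst 1))))))).

Definition attention_cmd :=
  Seq exp_bound_cmd (Seq value_bound_cmd (Seq degree_cmd (Seq main_loop divide_cmd))).

Lemma attention_slow : cslow attention_cmd. Proof. by []. Qed.

Definition mono_time d G := (1 + for_time d (for_time (G + G) 1))%N.

Definition column_time n d G :=
  ((1 + (1 + for_time n (mono_time d G + (mono_time d G + (1 + 1)))) +
    for_time n (mono_time d G + 1)) * 2)%N.

Definition term_time n d G :=
  (1 + for_time (3 * d) (for_time G 1) + for_time d (column_time n d G))%N.

(** * Verification of the contribution of a single multi-index *)

Section Spec.
Variable R : realType.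
Implicit Types (s : state R).

Definition mono (d : nat) (A : nat -> nat) (x : nat -> R) (o1 o2 i : nat) : R :=
  \prod_(l < d) x (i * d + l)%N ^+ (A (l + o1 * d)%N + A (l + o2 * d)%N).

Definition coef d (A : nat -> nat) : R :=
  \prod_(l < 3 * d) \prod_(m < A l) (d * (m + 1))%:R^-1.

Definition mono_sum (n d : nat) A x (y : nat -> R) (o1 o2 : nat) : R :=
  \sum_(j < n) mono d A x o1 o2 j * y j.

Definition term n d A (x1 x2 x3 y2 y3 : nat -> R) i : R :=
  coef d A * mono d A x1 0 2 i * mono_sum n d A x2 y2 0 1 * mono_sum n d A x3 y3 1 2.

Definition exps_le d (A : nat -> nat) G := forall l, (l < 3 * d)%N -> (A l <= G)%N.

Lemma runs_mono (p a o1 o2 : nat) s G : p != a -> (o1 < 3)%N -> (o2 < 3)%N ->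
  exps_le (imem s 0 1) (imem s 2) G ->
  runs (mono_cmd p a o1 o2) s (mono_time (imem s 0 1) G)
    (fun s' => rmem s' p 0 =
       mono (imem s 0 1) (imem s 2) (rmem s a) o1 o2 (imem s 6 0)).
Proof.
rewrite eq_sym => ap o13 o23 AG; have hp : a \notin [:: p] by rewrite inE.
set d := imem s 0 1; set A := imem s 2.
apply: (@runs_seq _ (fun s' => s' = State (imem s) (upd (rmem s) p 0 1))).
  exact: runs_rset.
move=> _ -> _; set s0 := State _ _.
apply: (runs_for (I := fun k s' => rmem s' p 0 =
    \prod_(l < k) rmem s a (imem s 6 0 * d + l)%N ^+ (A (l + o1 * d)%N + A (l + o2 * d)%N))) => //.
- by move=> s' ss /=; rewrite (same_i ss).
- by rewrite big_ord0 /= /upd !eqxx.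
move=> k s1 kd ss Ik vk.
have i0 : imem s1 0 = imem s 0 by rewrite (same_i ss).
have i2 : imem s1 2 = imem s 2 by rewrite (same_i ss).
have i6 : imem s1 6 = imem s 6 by rewrite (same_i ss).
have ra : rmem s1 a = rmem s a.
  by rewrite (same_r ss)//= upd_neq.
set e := (A (k + o1 * d)%N + A (k + o2 * d)%N)%N.
apply: runs_weak.
- apply: (runs_for (m := e) (mb := (G + G)%N) (U := 1) (I := fun m s' => rmem s' p 0 =
    (\prod_(l < k) rmem s a (imem s 6 0 * d + l)%N ^+ (A (l + o1 * d)%N + A (l + o2 * d)%N)) *
    rmem s a (imem s 6 0 * d + k)%N ^+ m)) => //.
  + by rewrite leq_add// AG//; move: kd o13 o23; rewrite -/d; nia.
  + by move=> s2 ss2 /=; rewrite !(same_i ss2)// vk i0 i2.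
  + by rewrite /= expr0 mulr1.
  move=> m s2 me ss2 Im vm; apply: runs_rset => _.
  rewrite /= /upd !eqxx/= Im (same_r ss2)//.
  by rewrite ra !(same_i ss2)// i6 i0 vk -/d exprSr mulrA.
- by [].
- by move=> s2 Im ss2 ss3; rewrite big_ord_recr.
Qed.

(** The values of [e2] and [e3] are assumed in every state within the frame, because they are
    evaluated after scratch cells have changed, [e3] even after cell 17 has. *)
Lemma runs_sums e2 e3 (y2 y3 : nat -> R) s G :
  exps_le (imem s 0 1) (imem s 2) G ->
  (forall s' j, same (sums_cmd e2 e3) s s' -> (j < imem s 0 0)%N -> imem s' 6 0 = j ->
    reval s' e2 = y2 j /\ reval s' e3 = y3 j) ->
  runs (sums_cmd e2 e3) s
    (1 + (1 + for_time (imem s 0 0) (mono_time (imem s 0 1) G +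
      (mono_time (imem s 0 1) G + (1 + 1)))))
    (fun s' =>
       rmem s' 17 0 = mono_sum (imem s 0 0) (imem s 0 1) (imem s 2) (rmem s 2) y2 0 1 /\
       rmem s' 18 0 = mono_sum (imem s 0 0) (imem s 0 1) (imem s 2) (rmem s 3) y3 1 2).
Proof.
move=> AG ey; set d := imem s 0 1; set n := imem s 0 0; set A := imem s 2.
apply: (@runs_seq _ (fun s' => s' = State (imem s) (upd (rmem s) 17 0 0))).
  exact: runs_rset.
move=> _ -> _; set s0 := State _ _.
apply: (@runs_seq _ (fun s' => s' = State (imem s) (upd (rmem s0) 18 0 0))).
  exact: runs_rset.
move=> _ -> _; set s1 := State _ _.
have ss1 : same (sums_cmd e2 e3) s s1.
  by split=> // a /=; rewrite !inE !negb_or => /and3P[h17 h18 _]; rewrite !upd_neq.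
apply: (runs_for (I := fun k s' =>
    rmem s' 17 0 = mono_sum k d A (rmem s 2) y2 0 1 /\
    rmem s' 18 0 = mono_sum k d A (rmem s 3) y3 1 2)) => //.
- by move=> s' ss /=; rewrite (same_i ss).
- by rewrite /mono_sum !big_ord0.
move=> k s2 kn ss [I17 I18] vk.
have {ss}ss2 : same (sums_cmd e2 e3) s s2.
  apply: same_trans ss1 (same_sub _ _ ss); exact/allP.
have M14 := @runs_mono 14%N 2%N 0 1 s2 G isT isT isT.
rewrite vk !(same_i ss2)// !(same_r ss2)// in M14.
apply: (runs_seq (M14 AG)) => s3 P14 ss3.
have k3 : imem s3 6 0 = k by rewrite (same_i ss3).
have M15 := @runs_mono 15%N 3%N 1 2 s3 G isT isT isT.
rewrite k3 !(same_i ss3)// !(same_i ss2)// !(same_r ss3)// !(same_r ss2)// in M15.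
apply: (runs_seq (M15 AG)) => s4 P15 ss4.
have ss24 : same (sums_cmd e2 e3) s s4.
  apply: same_trans ss2 (same_trans (same_sub _ _ ss3) (same_sub _ _ ss4));
  exact/allP.
have k4 : imem s4 6 0 = k by rewrite (same_i ss4).
have [E2 E3] := ey _ _ ss24 kn k4.
apply: (@runs_seq _ (fun s' => s' = State (imem s4)
    (upd (rmem s4) 17 0 (mono_sum k.+1 d A (rmem s 2) y2 0 1)))).
  apply: runs_rset; rewrite /= E2 (same_r ss4)// (same_r ss3)// I17 (same_r ss4)// P14.
  by rewrite /mono_sum big_ord_recr.
move=> _ -> ss5; set s5 := State _ _.
have ss25 : same (sums_cmd e2 e3) s s5.
  by apply: same_trans ss24 (same_sub _ _ ss5); exact/allP.
have [_ E3'] := ey _ _ ss25 kn k4.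
apply: runs_rset => _; rewrite /= E3' /upd /= P15.
rewrite (_ : rmem s4 18 0 = mono_sum k d A (rmem s 3) y3 1 2); last first.
  by rewrite (same_r ss4)// (same_r ss3).
by rewrite /mono_sum !big_ord_recr.
Qed.

Lemma cell_inj d i i' l l' : (l < d)%N -> (l' < d)%N ->
  (i * d + l == i' * d + l')%N = (i == i') && (l == l').
Proof.
move=> ld ld'; apply/eqP/andP => [e|[/eqP-> /eqP->]//].
have d0 : (0 < d)%N by apply: leq_ltn_trans ld.
have := congr1 (divn^~ d) e; rewrite !divnMDl// !divn_small// !addn0 => ->.
by have := congr1 (modn^~ d) e; rewrite !modnMDl !modn_small// => ->; rewrite !eqxx.
Qed.

Definition scatter_val s i : R :=
  rmem s 13 0 * mono (imem s 0 1) (imem s 2) (rmem s 1) 0 2 i * rmem s 17 0 * rmem s 18 0.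

(** The range of [arr] keeps the target apart from the input matrices and from the real arrays 13 to
    18 that the body uses. *)
Lemma runs_scatter (arr : nat) s G : (5 < arr < 13)%N ->
  exps_le (imem s 0 1) (imem s 2) G -> (imem s 5 0 < imem s 0 1)%N ->
  runs (scatter_cmd arr) s (for_time (imem s 0 0) (mono_time (imem s 0 1) G + 1))
    (fun s' => forall i l, (l < imem s 0 1)%N ->
       rmem s' arr (i * imem s 0 1 + l)%N = rmem s arr (i * imem s 0 1 + l)%N +
         if (i < imem s 0 0)%N && (l == imem s 5 0) then scatter_val s i else 0).
Proof.
move=> harr AG l0d; set d := imem s 0 1; set n := imem s 0 0.
apply: (runs_for (I := fun k s' => forall i l, (l < d)%N ->
  rmem s' arr (i * d + l)%N = rmem s arr (i * d + l)%N +
         if (i < k)%N && (l == imem s 5 0) then scatter_val s i else 0)) => //.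
- by move=> s' ss /=; rewrite (same_i ss).
- by move=> i l _; rewrite /= addr0.
move=> k s1 kn ss Ik vk.
have fr a : a \notin [:: 16; arr] -> rmem s1 a = rmem s a.
  move=> h; rewrite (same_r ss)//; apply: contra h.
  by rewrite /= !inE => /or3P[] ->; rewrite ?orbT.
have r13 : rmem s1 13 = rmem s 13 by apply: fr; rewrite !inE; lia.
have r1 : rmem s1 1 = rmem s 1 by apply: fr; rewrite !inE; lia.
have r17 : rmem s1 17 = rmem s 17 by apply: fr; rewrite !inE; lia.
have r18 : rmem s1 18 = rmem s 18 by apply: fr; rewrite !inE; lia.
have M16 := @runs_mono 16%N 1%N 0 2 s1 G isT isT isT.
rewrite vk !(same_i ss)// r1 in M16.
apply: (runs_seq (M16 AG)) => s2 P16 ss2.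
apply: runs_rset => _ i l ld /=; rewrite /upd eqxx /=.
rewrite !(same_i ss2)// vk !(same_i ss)// cell_inj//.
have ra : rmem s2 arr = rmem s1 arr by rewrite (same_r ss2)//= !inE; lia.
rewrite ra P16 !(same_r ss2)// r13 r17 r18 !Ik// ltnn addr0.
rewrite [(i < k.+1)%N]ltnS [(i <= k)%N]leq_eqVlt.
by case: (eqVneq i k) => [->|ik] /=; rewrite ?ltnn //=; case: eqP => // ->.
Qed.

Lemma runs_column s G : exps_le (imem s 0 1) (imem s 2) G ->
  (imem s 5 0 < imem s 0 1)%N ->
  let n := imem s 0 0 in let d := imem s 0 1 in let l0 := imem s 5 0 in
  let val y2 y3 i := rmem s 13 0 * mono d (imem s 2) (rmem s 1) 0 2 i *
    mono_sum n d (imem s 2) (rmem s 2) y2 0 1 * mono_sum n d (imem s 2) (rmem s 3) y3 1 2 in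
  runs column_cmd s (column_time n d G)
    (fun s' => forall i l, (l < d)%N ->
       rmem s' 6 (i * d + l)%N = rmem s 6 (i * d + l)%N +
         (if (i < n)%N && (l == l0) then
            val (fun j => rmem s 4 (j * d + l)%N) (fun j => rmem s 5 (j * d + l)%N) i else 0) /\
       rmem s' 7 (i * d + l)%N = rmem s 7 (i * d + l)%N +
         (if (i < n)%N && (l == l0) then val (fun=> 1) (fun=> 1) i else 0)).
Proof.
move=> AG l0d n d l0 val.
rewrite /column_time muln2 -addnn.
apply: (@runs_seq _ (fun s' => forall i l, (l < d)%N ->
       rmem s' 6 (i * d + l)%N = rmem s 6 (i * d + l)%N +
         (if (i < n)%N && (l == l0) then
            val (fun j => rmem s 4 (j * d + l)%N) (fun j => rmem s 5 (j * d + l)%N) i else 0))).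
  apply: (runs_seq (runs_sums (G := G) (y2 := fun j => rmem s 4 (j * d + l0)%N)
     (y3 := fun j => rmem s 5 (j * d + l0)%N) AG _)).
    by move=> s' j ss jn vj; rewrite /= vj !(same_r ss)// !(same_i ss).
  move=> s1 [P17 P18] ss1.
  have := @runs_scatter 6%N s1 G isT; rewrite !(same_i ss1)// => /(_ AG l0d) h.
  apply: runs_weak h _ _ => // s2 h ss2 i l ld; rewrite h// !(same_r ss1)//.
  congr (_ + _); case: ifP => // /andP[_ /eqP->].
  by rewrite /scatter_val P17 P18 !(same_r ss1)// !(same_i ss1).
move=> s0 P6 ss0.
have e0 : imem s0 0 = imem s 0 by rewrite (same_i ss0).
have e2 : imem s0 2 = imem s 2 by rewrite (same_i ss0).
have AG0 : exps_le (imem s0 0 1) (imem s0 2) G by rewrite e0 e2.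
have := runs_sums (e2 := ROfInt (IConst 1)) (e3 := ROfInt (IConst 1))
  (y2 := fun=> 1) (y3 := fun=> 1) AG0 (fun _ _ _ _ _ => conj erefl erefl).
rewrite e0 => /runs_seq; apply => s1 [P17 P18] ss1.
have := @runs_scatter 7%N s1 G isT.
rewrite !(same_i ss1)// e0 e2 (same_i ss0)// => /(_ AG l0d) h.
apply: runs_weak h _ _ => // s2 h ss2 i l ld; split.
  by rewrite (same_r ss2)// (same_r ss1)// P6.
rewrite h// (same_r ss1)// (same_r ss0)//.
rewrite -/n -/l0; congr (_ + _); case: ifP => // _.
rewrite /scatter_val P17 P18 !(same_r ss1)// !(same_i ss1)// e0 e2 !(same_r ss0)//.
Qed.

Lemma runs_term s G : exps_le (imem s 0 1) (imem s 2) G ->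
  let n := imem s 0 0 in let d := imem s 0 1 in
  let val := term n d (imem s 2) (rmem s 1) (rmem s 2) (rmem s 3) in
  runs term_cmd s (term_time n d G)
    (fun s' => forall i l, (i < n)%N -> (l < d)%N ->
       rmem s' 6 (i * d + l)%N = rmem s 6 (i * d + l)%N +
         val (fun j => rmem s 4 (j * d + l)%N) (fun j => rmem s 5 (j * d + l)%N) i /\
       rmem s' 7 (i * d + l)%N = rmem s 7 (i * d + l)%N + val (fun=> 1) (fun=> 1) i).
Proof.
move=> AG n d val; set A := imem s 2.
apply: (@runs_seq _ (fun s' => rmem s' 13 0 = coef d A)).
  apply: (@runs_seq _ (fun s' => s' = State (imem s) (upd (rmem s) 13 0 1))).
    exact: runs_rset.
  move=> _ -> _; set s0 := State _ _.
  apply: (runs_for (I := fun k s' => rmem s' 13 0 =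
      \prod_(l < k) \prod_(m < A l) (d * (m + 1))%:R^-1)) => //.
  - by move=> s' ss /=; rewrite (same_i ss).
  - by rewrite big_ord0.
  move=> k s1 kd ss Ik vk.
  have i0 : imem s1 0 = imem s 0 by rewrite (same_i ss).
  have i2 : imem s1 2 = imem s 2 by rewrite (same_i ss).
  apply: runs_weak.
  - apply: (runs_for (m := A k) (mb := G) (U := 1) (I := fun m' s' => rmem s' 13 0 =
      (\prod_(l < k) \prod_(m < A l) (d * (m + 1))%:R^-1) *
      \prod_(m < m') (d * (m + 1))%:R^-1)) => //.
    + by rewrite AG.
    + by move=> s2 ss2 /=; rewrite !(same_i ss2)// vk i2.
    + by rewrite /= big_ord0 mulr1.
    move=> m s2 me ss2 Im vm; apply: runs_rset => _.
    by rewrite /= /upd !eqxx/= Im vm !(same_i ss2)// i0 big_ord_recr mulrA.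
  - by [].
  - by move=> s2 Im ss2 ss3; rewrite big_ord_recr.
move=> s0 P13 ss0.
apply: runs_weak; last first.
- move=> s' Q _; exact: Q.
- exact: leqnn.
- apply: runs_weak.
  apply: (runs_for (m := d) (mb := d) (U := column_time n d G)
   (I := fun k s' => forall i l, (i < n)%N -> (l < d)%N ->
       rmem s' 6 (i * d + l)%N = rmem s 6 (i * d + l)%N + (if (l < k)%N then
         val (fun j => rmem s 4 (j * d + l)%N) (fun j => rmem s 5 (j * d + l)%N) i else 0) /\
       rmem s' 7 (i * d + l)%N = rmem s 7 (i * d + l)%N + (if (l < k)%N then
          val (fun=> 1) (fun=> 1) i else 0))) => //.
  + by move=> s' ss /=; rewrite (same_i ss)// (same_i ss0).
  + by move=> i l _ _; rewrite !addr0 /= !(same_r ss0).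
  + move=> k s1 kd ss Ik vk.
    have fi a : a \notin modi term_cmd -> imem s1 a = imem s a.
      move=> h; rewrite (same_i ss) ?(same_i ss0)//; apply: contra h; move: a; exact/allP.
    have fr a : a \in [:: 1; 2; 3; 4; 5] -> rmem s1 a = rmem s a.
      by rewrite !inE => /or4P[/eqP->|/eqP->|/eqP->|/orP[]/eqP->];
         rewrite (same_r ss)// (same_r ss0).
    have r13 : rmem s1 13 0 = coef d A by rewrite (same_r ss).
    have := @runs_column s1 G; rewrite vk !fi// => /(_ AG kd) h.
    apply: runs_weak h _ _ => // s2 h ss2 ss2' i l ni ld /=.
    have [-> ->] := h i l ld; have [-> ->] := Ik i l ni ld.
    rewrite r13 !fr// ni [(l < k.+1)%N]ltnS [(l <= k)%N]leq_eqVlt /=.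
    by case: eqVneq => [->|lk] /=; rewrite ?ltnn ?addr0.
  + by [].
  + by move=> s' h ss' i l ni ld; have := h i l ni ld; rewrite ld.
Qed.

End Spec.

(** * Enumeration of the multi-indices *)

(* The successor of a multi-index in the order in which the last entry is the
   most significant one: increment the first entry for which this is possible
   after clearing the entries before it. *)
Fixpoint nxt (G : nat) (s : seq nat) : option (seq nat) :=
  if s is a :: s' then
    if (a + sumn s' < G)%N then Some (a.+1 :: s') else omap (cons 0%N) (nxt G s')
  else None.

(** The complete orbit of [nxt] from [s]; induction on it follows the passes of [main_loop]. *)
Inductive chain (G : nat) : seq nat -> seq (seq nat) -> Prop :=
| ChainEnd s : nxt G s = None -> chain G s [:: s]
| ChainStep s s' l : nxt G s = Some s' -> chain G s' l -> chain G s (s :: l).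

Fixpoint multi (D G : nat) : seq (seq nat) :=
  if D is D'.+1 then
    flatten [seq [seq a :: s | a <- iota 0 (G - sumn s).+1] | s <- multi D' G]
  else [:: [::]].

Lemma nxt_some G s s' : nxt G s = Some s' -> (size s' = size s) /\ (sumn s' <= G)%N.
Proof.
elim: s s' => //= a s IH s'; case: ifP => [aG [<-]//|_].
by case e : (nxt G s) => [t|]//= [<-]; have [h1 h2] := IH _ e; rewrite /= h1.
Qed.

(** For a fixed tail [s] the first entry climbs until the degree is exactly [G]; only then does the
    successor carry into [s], and the next block starts at 0. *)
Lemma chain_block G s tl k a : (a + k + sumn s = G)%N ->
  (if nxt G s is Some s' then chain G (0%N :: s') tl else tl = [::]) ->
  chain G (a :: s) ([seq b :: s | b <- iota a k.+1] ++ tl).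
Proof.
move=> + tlP; elim: k a => [|k IH] a ak.
  rewrite /=; case e : (nxt G s) tlP => [s'|] tlP.
    by apply: (@ChainStep _ _ (0%N :: s')); rewrite //= e -ak addn0 ltnn.
  by rewrite tlP; apply: ChainEnd; rewrite /= e -ak addn0 ltnn.
apply: (@ChainStep _ _ (a.+1 :: s)); first by rewrite /= ifT//; lia.
by apply: IH; lia.
Qed.

Lemma chain_flatten G s l : (sumn s <= G)%N -> chain G s l ->
  chain G (0%N :: s) (flatten [seq [seq a :: t | a <- iota 0 (G - sumn t).+1] | t <- l]).
Proof.
move=> + h; elim: h => {s l} [s e|s s' l e _ IH] sG.
  rewrite [flatten _]/=; apply: (@chain_block _ _ _ (G - sumn s)); last by rewrite e.
  by rewrite add0n subnK.
rewrite [flatten _]/= -cat_cons; apply: (@chain_block _ _ _ (G - sumn s)).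
  by rewrite add0n subnK.
by rewrite e; apply: IH; case: (nxt_some e).
Qed.

Lemma sumn_nseq0 D : sumn (nseq D 0%N) = 0%N.
Proof. by rewrite sumn_nseq mul0n. Qed.

Lemma chain_multi D G : chain G (nseq D 0%N) (multi D G).
Proof.
elim: D => [|D IH]; first exact: ChainEnd.
by apply: chain_flatten => //; rewrite sumn_nseq0.
Qed.

Lemma leq_nth_sumn s k : (nth 0%N s k <= sumn s)%N.
Proof.
elim: s k => [|a s IH] [|k] //=; first by rewrite leq_addr.
by apply: leq_trans (IH k) _; rewrite leq_addl.
Qed.

Definition next_time D := (1 + (D * 4 + 4))%N.

Definition loop_time n d G :=
  (size (multi (3 * d) G) * (1 + (term_time n d G + next_time (3 * d))) + 1)%N.

Definition program_time n d N G :=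
  ((1 + (1 + (N * 3 + 1))) + ((1 + for_time (n * d) 2) + ((1 + (G * 3 + 1)) +
   (loop_time n d G + for_time (n * d) 1))))%N.

(** * Verification of the enumeration, the parameter searches and the whole program *)

Section Spec2.
Variable R : realType.
Implicit Types (s : state R).

(** Unrolls a loop that is followed by another command, so that [runs_next] can treat carrying and
    incrementing in one induction, with no assertion between them. *)
Lemma runs_seq_whileT b c c' s U U' (Q : state R -> Prop) :
  beval s b ->
  runs c s U (fun s' => same c s s' -> runs (Seq (While b c) c') s' U' Q) ->
  runs (Seq (While b c) c') s (1 + U + U') Q.
Proof.
move=> hb [u [s' [h hu /(_ (run_same h))]]] [u' [s'' [h' hu' q]]].
inversion h' as [| | |? ? ? s1 ? v v' hw hc'| | |]; subst.
exists (1 + u + v + v')%N, s''; split=> //; last by move: hu hu'; lia.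
by apply: RunSeq hc'; apply: RunWhileT hb h hw.
Qed.

(** [w] is the part of the multi-index from position [l] on, and the induction follows the recursion
    of [nxt]. The clause on positions below [l] is what shows that cleared entries remain 0. *)
Lemma runs_next w l s : imem s 10 0 = l -> (l + size w = 3 * imem s 0 1)%N ->
  (forall k, (k < size w)%N -> imem s 2 (l + k)%N = nth 0%N w k) ->
  imem s 3 0 = sumn w -> (sumn w <= imem s 1 0)%N ->
  runs (Seq carry_cmd incr_cmd) s (size w * 4 + 4)
    (fun s' => if nxt (imem s 1 0) w is Some w' then
       [/\ imem s' 4 0 = imem s 4 0,
          forall k, (k < size w)%N -> imem s' 2 (l + k)%N = nth 0%N w' k,
          imem s' 3 0 = sumn w' &
          forall k, (k < l)%N -> imem s' 2 k = imem s 2 k]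
     else imem s' 4 0 = 1%N).
Proof.
set G := imem s 1 0; set d := imem s 0 1.
have [m] := ubnP (size w); elim: m s w l @G @d => // m IH s w l G d wm il lD aw tw wG.
case: w wm lD aw tw wG => [|a w] wm lD aw tw wG.
  rewrite mul0n add0n addn0 in lD *.
  apply: (@runs_weak _ _ _ (1 + 2)); last 2 first; [by []|by move=> s' h _; exact: h|].
  apply: (@runs_seq _ (fun s' => s' = s)).
    by apply: runs_whileF => //=; rewrite il lD -/d ltnn.
  move=> _ -> _; apply: runs_if; rewrite /= il lD -/d ltnn /=.
  by apply: runs_iset.
have lD' : (l < 3 * d)%N by rewrite -lD /= -addSnnS leq_addr.
have al : imem s 2 l = a by rewrite -[l]addn0 aw.
have [aG|aG] := ltnP (a + sumn w) G.
  rewrite [nxt _ _]/= aG.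
  apply: (@runs_weak _ _ _ (1 + 3)); last 2 first.
  - by rewrite leq_addl.
  - by move=> s' h _; exact: h.
  apply: (@runs_seq _ (fun s' => s' = s)).
    by apply: runs_whileF => //=; rewrite tw aG andbF.
  move=> _ -> _; apply: runs_if; rewrite /= il -/d lD'.
  apply: (@runs_seq _ (fun s' => s' =
      State (upd (imem s) 2 l a.+1) (rmem s)) _ _ _ 1 1).
    by apply: runs_iset; rewrite /= il al addn1.
  move=> _ -> _; apply: runs_iset; split=> //=.
  - case=> [|k] /= kw; first by rewrite addn0 /upd /= eqxx.
    rewrite {1 2}/upd /= ifF ?aw//.
    by apply/negbTE; rewrite -{2}[l]addn0 eqn_add2l.
  - by rewrite /upd /= tw /= addn1 addSn.
  - by move=> k kl; rewrite {1 2}/upd /= ifF// ltn_eqF.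
(* The degree is full: one pass of the carry loop, a test and three assignments, leaves the same
   problem for the tail at [l.+1]. *)
rewrite [size _]/= mulSn (_ : (4 + size w * 4 + 4 = 1 + (1 + (1 + 1)) + (size w * 4 + 4))%N); last by lia.
apply: runs_seq_whileT; first by rewrite /= il tw -/d lD' -leqNgt.
apply: (@runs_seq _ (fun s' => s' =
      State (upd (imem s) 3 0 (sumn w)) (rmem s))).
  by apply: runs_iset; rewrite /= il al tw /= addKn.
move=> _ -> _.
apply: (@runs_seq _ (fun s' => s' =
      State (upd (upd (imem s) 3 0 (sumn w)) 2 l 0) (rmem s))).
  by apply: runs_iset; rewrite /= [upd _ _ _ _ 10]upd_neq// il.
move=> _ -> _; apply: runs_iset => _.
set s1 := State _ _.
have s10 : imem s1 10 0 = l.+1 by rewrite /s1 /= /upd /= il addn1.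
have h0 : (l.+1 + size w = 3 * imem s1 0 1)%N by rewrite /s1 /= /upd /= -/d -lD addSnnS.
have h1 k : (k < size w)%N -> imem s1 2 (l.+1 + k)%N = nth 0%N w k.
  move=> kw; rewrite /s1 /= {1 2 3}/upd /= ifF ?addSnnS ?aw//.
  by apply/negbTE; rewrite -{2}[l]addn0 eqn_add2l.
have h2 : imem s1 3 0 = sumn w by [].
have h3 : (sumn w <= imem s1 1 0)%N.
  by apply: leq_trans wG; rewrite /= leq_addl.
apply: runs_weak (IH s1 w l.+1 _ s10 h0 h1 h2 h3) _ _ => // s2.
rewrite (_ : imem s1 1 0 = G)// [nxt G (_ :: _)]/= ltnNge aG /=.
case e : (nxt G w) => [w'|]//= [a1 a2 a3 a4] _; split=> //.
- case=> [|k] kw; last by rewrite -addSnnS a2.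
  by rewrite addn0 a4// /s1 /= /upd /= eqxx.
- move=> k kl; rewrite a4 ?(leq_trans kl)// /s1 /= {1 2 3}/upd /= ifF//.
  by rewrite ltn_eqF.
Qed.

Lemma eq_mono d A A' (x : nat -> R) (o1 o2 i : nat) : (o1 < 3)%N -> (o2 < 3)%N ->
  (forall l, (l < 3 * d)%N -> A l = A' l) -> mono d A x o1 o2 i = mono d A' x o1 o2 i.
Proof.
by move=> o13 o23 AA'; apply: eq_bigr => l _; rewrite !AA'//; move: (ltn_ord l); nia.
Qed.

Lemma eq_term n d A A' (x1 x2 x3 y2 y3 : nat -> R) i :
  (forall l, (l < 3 * d)%N -> A l = A' l) ->
  term n d A x1 x2 x3 y2 y3 i = term n d A' x1 x2 x3 y2 y3 i.
Proof.
move=> AA'; rewrite /term (eq_mono _ _ _ _ AA')//; congr (_ * _ * _ * _).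
- by apply: eq_bigr => l _; rewrite AA'.
- by apply: eq_bigr => j _; rewrite (eq_mono _ _ _ _ AA').
- by apply: eq_bigr => j _; rewrite (eq_mono _ _ _ _ AA').
Qed.

Lemma runs_main w L s n d G : chain G w L ->
  imem s 0 0 = n -> imem s 0 1 = d -> imem s 1 0 = G -> imem s 4 0 = 0%N ->
  (forall k, (k < 3 * d)%N -> imem s 2 k = nth 0%N w k) -> imem s 3 0 = sumn w ->
  size w = (3 * d)%N -> (sumn w <= G)%N ->
  let val alpha := term n d (nth 0%N alpha) (rmem s 1) (rmem s 2) (rmem s 3) in
  runs main_loop s (size L * (1 + (term_time n d G + next_time (3 * d))) + 1)
    (fun s' => forall i l, (i < n)%N -> (l < d)%N ->
       rmem s' 6 (i * d + l)%N = rmem s 6 (i * d + l)%N + \sum_(alpha <- L)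
         val alpha (fun j => rmem s 4 (j * d + l)%N) (fun j => rmem s 5 (j * d + l)%N) i /\
       rmem s' 7 (i * d + l)%N = rmem s 7 (i * d + l)%N +
         \sum_(alpha <- L) val alpha (fun=> 1) (fun=> 1) i).
Proof.
move=> ch; elim: ch s => {w L} [w e|w w' L e _ IH] s i00 i01 i1 i4 i2 i3 sw wG val.
all: have AG : exps_le (imem s 0 1) (imem s 2) G
  by move=> k; rewrite i01 => kd; rewrite i2//; apply: leq_trans (leq_nth_sumn _ _) wG.
all: rewrite [size _]/= mulSn -addnA; apply: runs_whileT; first by rewrite /= i4.
all: have := runs_term AG; rewrite i00 i01 => /= Ht; apply: (runs_seq Ht) => s1 P1 ss1.
all: apply: (@runs_seq _ (fun s' => s' = State (upd (imem s1) 10 0 0) (rmem s1)));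
  [exact: runs_iset|move=> _ -> _].
all: set s2 := State _ _.
all: have a1 : imem s2 10 0 = 0%N by [].
all: have a2 : (0 + size w = 3 * imem s2 0 1)%N
  by rewrite sw /s2 /= upd_neq// (same_i ss1)// i01.
all: have a3 : forall k, (k < size w)%N -> imem s2 2 (0 + k)%N = nth 0%N w k
  by move=> k kw; rewrite /s2 /= upd_neq// (same_i ss1)// i2// -sw.
all: have a4 : imem s2 3 0 = sumn w by rewrite /s2 /= upd_neq// (same_i ss1).
all: have a5 : imem s2 1 0 = G by rewrite /s2 /= upd_neq// (same_i ss1).
all: have := runs_next a1 a2 a3 a4; rewrite a5 e sw => /(_ wG) Hn.
all: have vE y2 y3 i : term n d (imem s 2) (rmem s 1) (rmem s 2) (rmem s 3) y2 y3 i =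
  val w y2 y3 i by apply: eq_term => l ld; rewrite i2.
- apply: runs_weak Hn _ _ => // s3 h ss3 ss.
  apply: runs_whileF; first by rewrite /= h.
  move=> i l ni ld; rewrite !big_seq1 !(same_r ss3)//= -!vE; exact: P1.
- apply: runs_weak Hn _ _ => // s3 [b1 b2 b3 b4] ss3 ss.
  have [sw' wG'] := nxt_some e.
  have c1 : imem s3 4 0 = 0%N by rewrite b1 /= /s2 /= upd_neq// (same_i ss1).
  have c0 : imem s3 0 = imem s 0 by rewrite (same_i ss).
  have c2 k : (k < 3 * d)%N -> imem s3 2 k = nth 0%N w' k by move=> kd; rewrite -b2.
  have c5 : imem s3 1 0 = G by rewrite (same_i ss).
  have c6 : size w' = (3 * d)%N by rewrite sw'.
  have := IH s3; rewrite !c0 => /(_ i00 i01 c5 c1 c2 b3 c6 wG') H.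
  apply: runs_weak H _ _ => // s4 H ss4 i l ni ld.
  have [-> ->] := H i l ni ld; rewrite !big_cons !(same_r ss3)//=.
  have [-> ->] := P1 i l ni ld; rewrite !vE !addrA.
  by rewrite !(same_r ss1).
Qed.

Lemma runs_divide s n d : imem s 0 0 = n -> imem s 0 1 = d ->
  runs divide_cmd s (for_time (n * d) 1)
    (fun s' => forall k, (k < n * d)%N -> rmem s' 6 k = rmem s 6 k / rmem s 7 k).
Proof.
move=> i0 i1; apply: (@runs_weak _ _ _ (for_time (n * d) 1) _ (fun s' => forall k,
    rmem s' 6 k = if (k < n * d)%N then rmem s 6 k / rmem s 7 k else rmem s 6 k)) => //;
  last by move=> s' h _ k kn; rewrite h kn.
apply: (runs_for (m := (n * d)%N) (I := fun m s' => forall k,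
    rmem s' 6 k = if (k < m)%N then rmem s 6 k / rmem s 7 k else rmem s 6 k)) => //.
  by move=> s' ss /=; rewrite !(same_i ss)// i0 i1.
move=> k s1 kn ss Ik vk; apply: runs_rset => _ j.
rewrite /= vk Ik ltnn (same_r ss)// ltnS leq_eqVlt /upd eqxx /=.
by case: eqVneq => [->|].
Qed.

Lemma runs_exp_bound s N (B := 3 * rmem s 0 0 * rmem s 0 0) : rmem s 9 0 = 0 ->
  B <= N%:R -> (forall m, (m < N)%N -> m%:R < B) ->
  runs exp_bound_cmd s (1 + (1 + (N * 3 + 1)))
    (fun s' => rmem s' 8 0 = B /\ rmem s' 10 0 = 16%:R ^+ N).
Proof.
move=> r9 BN NB.
apply: (@runs_seq _ (fun s' => s' = State (imem s) (upd (rmem s) 8 0 B))).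
  exact: runs_rset.
move=> _ -> _; apply: (@runs_seq _ (fun s' => s' =
    State (imem s) (upd (upd (rmem s) 8 0 B) 10 0 1))).
  exact: runs_rset.
move=> _ -> _; set s0 := State _ _.
suff loop m : forall k s0, (k + m = N)%N ->
    [/\ rmem s0 8 0 = B, rmem s0 9 0 = k%:R & rmem s0 10 0 = 16%:R ^+ k] ->
    runs (While (BRLt (rv 9) (rv 8)) (Seq (radd 9 (ROfInt (IConst 1)))
        (RSet 10 (IConst 0) (RMul (rv 10) (ROfInt (IConst 16)))))) s0 (m * 3 + 1)
      (fun s' => rmem s' 8 0 = B /\ rmem s' 10 0 = 16%:R ^+ N).
  by apply: (loop N 0%N); rewrite /s0 /= /upd /= ?r9 ?expr0.
elim: m => [|m IH] k {}s0 kN [r8 r9' r10].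
  apply: runs_whileF; first by rewrite /= r8 r9' -leNgt -(addn0 k) kN.
  by rewrite r8 r10 -kN addn0.
rewrite mulSn -addnA (_ : (3 + (m * 3 + 1) = 1 + (1 + 1) + (m * 3 + 1))%N)//.
apply: runs_whileT; first by rewrite /= r8 r9' NB// -kN; lia.
apply: (@runs_seq _ (fun s' => s' = State (imem s0) (upd (rmem s0) 9 0 k.+1%:R))).
  by apply: runs_rset; rewrite /= r9' natr1.
move=> _ -> _; apply: runs_rset => _.
apply: (IH k.+1); first by rewrite addSnnS.
by rewrite /= /upd /= r8 r10 exprSr.
Qed.

Lemma runs_value_bound s n d : imem s 0 0 = n -> imem s 0 1 = d ->
  runs value_bound_cmd s (1 + for_time (n * d) 2)
    (fun s' => rmem s' 11 0 = 1 + \sum_(k < n * d) (rmem s 4 k ^+ 2 + rmem s 5 k ^+ 2)).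
Proof.
move=> i0 i1; apply: (@runs_seq _ (fun s' => s' = State (imem s) (upd (rmem s) 11 0 1))).
  exact: runs_rset.
move=> _ -> _; set s0 := State _ _.
apply: (runs_for (I := fun m s' =>
    rmem s' 11 0 = 1 + \sum_(k < m) (rmem s 4 k ^+ 2 + rmem s 5 k ^+ 2))) => //.
  by move=> s' ss /=; rewrite !(same_i ss)//= i0 i1.
  by rewrite big_ord0 addr0.
move=> k s1 kn ss Ik vk.
have r4 : rmem s1 4 = rmem s 4 by rewrite (same_r ss).
have r5 : rmem s1 5 = rmem s 5 by rewrite (same_r ss).
apply: (@runs_seq _ (fun s' => s' = State (imem s1) (upd (rmem s1) 11 0
   (rmem s1 11 0 + rmem s 4 k ^+ 2))) _ _ _ 1 1).
  by apply: runs_rset; rewrite /= vk r4.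
move=> _ -> _; apply: runs_rset => _.
by rewrite /= /upd /= vk Ik r5 big_ord_recr /= !addrA !expr2.
Qed.

Definition error_bound (C B : R) G := C * B ^+ G.+1 / (G.+1)`!%:R.

Lemma runs_degree s G (C := 4 * rmem s 11 0 * rmem s 10 0 * (1 + 1 / rmem s 0 1))
    (B := rmem s 8 0) : imem s 1 0 = 0%N ->
  error_bound C B G <= 1 -> (forall g, (g < G)%N -> 1 < error_bound C B g) ->
  runs degree_cmd s (1 + (G * 3 + 1)) (fun s' => imem s' 1 0 = G).
Proof.
move=> i1 CG gC.
apply: (@runs_seq _ (fun s' => s' = State (imem s) (upd (rmem s) 12 0 (C * B)))).
  exact: runs_rset.
move=> _ -> _; set s0 := State _ _.
suff loop m : forall k s0, (k + m = G)%N ->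
    [/\ imem s0 1 0 = k, rmem s0 12 0 = error_bound C B k & rmem s0 8 0 = B] ->
    runs (While (BRLt (ROfInt (IConst 1)) (rv 12))
      (Seq (ISet 1 (IConst 0) (IAdd (iv 1) (IConst 1)))
        (RSet 12 (IConst 0)
          (RDiv (RMul (rv 12) (rv 8)) (ROfInt (IAdd (iv 1) (IConst 1))))))) s0 (m * 3 + 1)
      (fun s' => imem s' 1 0 = G).
  by apply: (loop G 0%N); rewrite // /s0 /= i1 /upd /= /error_bound expr1 factS fact0 muln1 divr1.
elim: m => [|m IH] k {}s0 kG [j1 r12 r8].
  rewrite addn0 in kG; apply: runs_whileF; last by rewrite j1.
  by rewrite /= r12 -leNgt kG.
rewrite mulSn -addnA (_ : (3 + (m * 3 + 1) = 1 + (1 + 1) + (m * 3 + 1))%N)//.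
apply: runs_whileT; first by rewrite /= r12 gC// -kG; lia.
apply: (@runs_seq _ (fun s' => s' = State (upd (imem s0) 1 0 k.+1) (rmem s0))).
  by apply: runs_iset; rewrite /= j1 addn1.
move=> _ -> _; apply: runs_rset => _.
apply: (IH k.+1); first by rewrite addSnnS.
rewrite /= /upd /= r12 r8; split=> //.
by rewrite /error_bound addn1 (exprS B k.+1) (factS k.+1) natrM invfM; ring.
Qed.

Definition attention_approx n d G (x1 x2 x3 y2 y3 : nat -> R) i : R :=
  \sum_(alpha <- multi (3 * d) G) term n d (nth 0%N alpha) x1 x2 x3 y2 y3 i.

(** The minimality of [N] and [G] is exactly what makes the two search loops take [N] and [G]
    passes. *)
Lemma runs_attention n d (Gamma gamma : R) (Q1 Q2 Q3 V2 V3 : 'M[R]_(n, d)) N G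
    (x := fun M : 'M[R]_(n, d) => mx_cells M)
    (B := 3 * Gamma * Gamma)
    (C := 4 * (1 + \sum_(k < n * d) (x V2 k ^+ 2 + x V3 k ^+ 2)) * 16%:R ^+ N *
          (1 + 1 / gamma)) :
  B <= N%:R -> (forall m, (m < N)%N -> m%:R < B) ->
  error_bound C B G <= 1 -> (forall g, (g < G)%N -> 1 < error_bound C B g) ->
  runs attention_cmd (input Gamma gamma Q1 Q2 Q3 V2 V3) (program_time n d N G)
    (fun s' => forall i l, (i < n)%N -> (l < d)%N ->
       rmem s' 6 (i * d + l)%N =
       attention_approx n d G (x Q1) (x Q2) (x Q3)
         (fun j => x V2 (j * d + l)%N) (fun j => x V3 (j * d + l)%N) i /
       attention_approx n d G (x Q1) (x Q2) (x Q3) (fun=> 1) (fun=> 1) i).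
Proof.
move=> BN NB CG gC; set s := input _ _ _ _ _ _ _.
apply: (runs_seq (runs_exp_bound (s := s) (N := N) _ _ _)) => //.
move=> s1 [r8 r10] ss1.
have H1 := @runs_value_bound s1 n d; rewrite !(same_i ss1)// in H1.
apply: (runs_seq (H1 erefl erefl)) => s2 r11 ss2.
have E8 : rmem s2 8 0 = B by rewrite (same_r ss2).
have E10 : rmem s2 10 0 = 16%:R ^+ N by rewrite (same_r ss2).
have E0 : rmem s2 0 = rmem s 0 by rewrite (same_r ss2)// (same_r ss1).
have H2 := @runs_degree s2 G.
rewrite r11 E8 E10 E0 (same_i ss2)// (same_i ss1)// !(same_r ss1)// in H2.
apply: (runs_seq (H2 erefl CG gC)) => s3 i3 ss3.
have F (b : nat) : b \in [:: 0; 2; 3; 4]%N -> imem s3 b = imem s b.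
  have /allP h : all (fun a => [&& a \notin modi degree_cmd, a \notin modi value_bound_cmd &
    a \notin modi exp_bound_cmd]) [:: 0; 2; 3; 4]%N by [].
  by case/h/and3P => h3 h2 h1; rewrite (same_i ss3)// (same_i ss2)// (same_i ss1).
have K (b : nat) : b \in [:: 1; 2; 3; 4; 5; 6; 7]%N -> rmem s3 b = rmem s b.
  have /allP h : all (fun a => [&& a \notin modr degree_cmd, a \notin modr value_bound_cmd &
    a \notin modr exp_bound_cmd]) [:: 1; 2; 3; 4; 5; 6; 7]%N by [].
  by case/h/and3P => h3 h2 h1; rewrite (same_r ss3)// (same_r ss2)// (same_r ss1).
have H3 := @runs_main _ _ s3 n d G (chain_multi (3 * d) G).
rewrite (F 0%N isT) (F 2%N isT) (F 3%N isT) (F 4%N isT) in H3.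
apply: (runs_seq (H3 erefl erefl i3 erefl _ _ _ _)).
- by move=> k kd; rewrite nth_nseq kd.
- by rewrite sumn_nseq0.
- by rewrite size_nseq.
- by rewrite sumn_nseq0.
move=> s4 H4 ss4.
have J : imem s4 0 = imem s 0 by rewrite (same_i ss4)// F.
have := @runs_divide s4 n d; rewrite J => /(_ erefl erefl) H5.
apply: runs_weak H5 _ _ => // s5 H5 ss5 i l ni ld.
rewrite H5; last by nia.
have [-> ->] := H4 i l ni ld.
by rewrite !K// !add0r.
Qed.

End Spec2.

(** * Accuracy of the truncated series *)

Section Correctness.
Variable R : realType.
Implicit Types (x B : R) (G : nat).

Definition taylor G x : R := \sum_(k < G.+1) x ^+ k / k`!%:R.

Lemma exp_partial_le B m : 0 <= B -> \sum_(k < m) B ^+ k / k`!%:R <= expR B.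
Proof.
move=> B0; rewrite -(big_mkord xpredT (fun k => B ^+ k / k`!%:R)).
apply: (@nondecreasing_cvgn_le R (series (exp_coeff B))) (is_cvg_series_exp_coeff B) m.
apply: nondecreasing_series => k _ _.
exact: exp_coeff_ge0.
Qed.

Lemma fact_mul_leq a b : (a`! * b`! <= (a + b)`!)%N.
Proof.
by rewrite -(bin_fact (leq_addr b a)) addKn leq_pmull// bin_gt0 leq_addr.
Qed.

(** Since [a! b! <= (a+b)!], the tail is dominated term by term by [B^(G+1) / (G+1)!] times the
    exponential series of [B]; the bound on partial sums passes to the limit. *)
Lemma exp_taylor G x B : `|x| <= B ->
  `|taylor G x - expR x| <= B ^+ G.+1 / (G.+1)`!%:R * expR B.
Proof.
move=> xB; have B0 : 0 <= B by apply: le_trans xB.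
set z := _ * expR B.
have dist m : `|\sum_(k < G.+1 + m) x ^+ k / k`!%:R - taylor G x| <= z.
  rewrite big_split_ord /= -/(taylor G x) [X in X - _]addrC addrK.
  apply: le_trans (ler_norm_sum _ _ _) _.
  apply: (@le_trans _ _ (\sum_(i < m) B ^+ G.+1 / (G.+1)`!%:R * (B ^+ i / i`!%:R))); last first.
    by rewrite -mulr_sumr ler_wpM2l ?exp_partial_le// divr_ge0 ?exprn_ge0.
  apply: ler_sum => i _; rewrite normrM normfV normrX normr_nat.
  rewrite mulrACA -exprD -invfM -natrM ler_pM ?exprn_ge0 ?invr_ge0//.
    by apply: lerXn2r; rewrite ?nnegrE.
  by rewrite lef_pV2 ?posrE ?ltr0n ?muln_gt0 ?fact_gt0// ler_nat fact_mul_leq.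
have near P : (forall m, P (\sum_(k < G.+1 + m) x ^+ k / k`!%:R)) ->
    \forall n \near \oo, P (series (exp_coeff x) n).
  move=> H; near=> n; have nG : (G.+1 <= n)%N by near: n; exact: nbhs_infty_ge.
  by rewrite /series /= big_mkord -(subnKC nG).
have cv := is_cvg_series_exp_coeff x.
rewrite distrC ler_distl; apply/andP; split.
  by apply: limr_ge => //; apply: (near (fun y => taylor G x - z <= y)) => m; have := dist m; rewrite ler_distl => /andP[].
by apply: limr_le => //; apply: (near (fun y => y <= taylor G x + z)) => m; have := dist m; rewrite ler_distl => /andP[].
Unshelve. all: by end_near. Qed.

Lemma sum_multi D G (f : seq nat -> R) :
  \sum_(alpha <- multi D.+1 G) f alpha =
  \sum_(s <- multi D G) \sum_(a < (G - sumn s).+1) f (nat_of_ord a :: s).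
Proof.
rewrite [multi _ _]/multi -/multi big_flatten big_map; apply: eq_bigr => s _.
by rewrite big_map -(big_mkord xpredT (fun a => f (a :: s))) /index_iota subn0.
Qed.

Lemma exp_coeffD x y n :
  \sum_(k < n.+1) (x ^+ k / k`!%:R) * (y ^+ (n - k) / (n - k)`!%:R) =
  (x + y) ^+ n / n`!%:R.
Proof.
rewrite addrC exprDn mulr_suml; apply: eq_bigr => k _.
have kn : (k <= n)%N by rewrite -ltnS.
rewrite -(bin_fact kn) !natrM -mulr_natr.
have h1 : (k`!%:R : R) != 0 by rewrite pnatr_eq0 -lt0n fact_gt0.
have h2 : ((n - k)`!%:R : R) != 0 by rewrite pnatr_eq0 -lt0n fact_gt0.
have h3 : ('C(n, k)%:R : R) != 0 by rewrite pnatr_eq0 -lt0n bin_gt0.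
by field; rewrite h1 h2 h3.
Qed.

Lemma sum_antidiagonal (G : nat) (F : nat -> nat -> R) :
  \sum_(k < G.+1) \sum_(a < (G - k).+1) F k a = \sum_(m < G.+1) \sum_(k < m.+1) F k (m - k)%N.
Proof.
elim: G F => [|G IH] F; first by rewrite !big_ord1.
rewrite big_ord_recr /= subnn big_ord1 [RHS]big_ord_recr /= -IH.
rewrite [X in _ = _ + X]big_ord_recr /= subnn addrA; congr (_ + _).
rewrite -big_split /=; apply: eq_bigr => k _.
by rewrite subSn -1?ltnS// big_ord_recr.
Qed.

Definition mono_exp D (z : nat -> R) (s : seq nat) : R :=
  \prod_(l < D) (z l ^+ nth 0%N s l / (nth 0%N s l)`!%:R).

(* A weight [F] depending on the degree makes the induction on the number of
   variables go through. *)
Lemma multinomial_exp D G (z F : nat -> R) :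
  \sum_(alpha <- multi D G) mono_exp D z alpha * F (sumn alpha) =
  \sum_(k < G.+1) (\sum_(l < D) z l) ^+ k / k`!%:R * F k.
Proof.
elim: D z F => [|D IH] z F.
  rewrite big_seq1 /mono_exp !big_ord0 big_ord_recl big1 ?addr0.
    by rewrite expr0 fact0 divr1 !mul1r.
  by move=> k _; rewrite expr0n /= !mul0r.
pose F' k : R := \sum_(a < (G - k).+1) z 0%N ^+ a / a`!%:R * F (k + a)%N.
rewrite sum_multi.
transitivity (\sum_(s <- multi D G) mono_exp D (fun l => z l.+1) s * F' (sumn s)).
  apply: eq_bigr => s _; rewrite mulr_sumr; apply: eq_bigr => a _.
  rewrite /mono_exp big_ord_recl /= addnC mulrA; congr (_ * _).
  by rewrite mulrC; congr (_ * _); apply: eq_bigr.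
rewrite IH.
transitivity (\sum_(k < G.+1) \sum_(a < (G - k).+1)
  (\sum_(l < D) z l.+1) ^+ k / k`!%:R * (z 0%N ^+ a / a`!%:R * F (k + a)%N)).
  by apply: eq_bigr => k _; rewrite mulr_sumr.
rewrite (sum_antidiagonal _ (fun k a => (\sum_(l < D) z l.+1) ^+ k / k`!%:R *
  (z 0%N ^+ a / a`!%:R * F (k + a)%N))).
apply: eq_bigr => m _.
rewrite [in RHS]big_ord_recl /= [z 0%N + _]addrC -exp_coeffD mulr_suml; apply: eq_bigr => k _.
by rewrite subnKC -1?ltnS// mulrA.
Qed.

Lemma sum3_ord d (F : nat -> R) :
  \sum_(l < 3 * d) F l = \sum_(l < d) (F l + F (l + d)%N + F (l + 2 * d)%N).
Proof.
rewrite !big_split /= (_ : (3 * d = d + (d + d))%N); last by lia.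
rewrite !big_split_ord /= -addrA; congr (_ + (_ + _)); apply: eq_bigr => l _.
  by rewrite addnC.
by congr F; lia.
Qed.

Lemma prod3_ord d (F : nat -> R) :
  \prod_(l < 3 * d) F l = \prod_(l < d) (F l * F (l + d)%N * F (l + 2 * d)%N).
Proof.
rewrite !big_split /= (_ : (3 * d = d + (d + d))%N); last by lia.
rewrite !big_split_ord /= -mulrA; congr (_ * (_ * _)); apply: eq_bigr => l _.
  by rewrite addnC.
by congr F; lia.
Qed.

Section Approx.
Variables (d : nat) (x1 x2 x3 : nat -> R).

Definition score i j k : R := \sum_(l < d)
  (x1 (i * d + l)%N * x2 (j * d + l)%N + x2 (j * d + l)%N * x3 (k * d + l)%N +
   x3 (k * d + l)%N * x1 (i * d + l)%N).

Lemma coefE (A : nat -> nat) : coef R d A = \prod_(l < 3 * d) (d%:R^-1 ^+ A l / (A l)`!%:R).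
Proof.
apply: eq_bigr => l _; elim: (A l) => [|m IH].
  by rewrite big_ord0 expr0 fact0 divr1.
by rewrite big_ord_recr /= IH addn1 natrM exprSr factS natrM !invfM; ring.
Qed.

Lemma mono_exp_split i j k (A : seq nat)
    (z := fun l => d%:R^-1 *
      if (l < d)%N then x1 (i * d + l)%N * x2 (j * d + l)%N
      else if (l < 2 * d)%N then x2 (j * d + (l - d))%N * x3 (k * d + (l - d))%N
      else x3 (k * d + (l - 2 * d))%N * x1 (i * d + (l - 2 * d))%N) :
  \sum_(l < 3 * d) z l = d%:R^-1 * score i j k /\
  mono_exp (3 * d) z A = coef R d (nth 0%N A) * mono d (nth 0%N A) x1 0 2 i *
    mono d (nth 0%N A) x2 0 1 j * mono d (nth 0%N A) x3 1 2 k.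
Proof.
have z0 l : (l < d)%N -> z l = d%:R^-1 * (x1 (i * d + l)%N * x2 (j * d + l)%N).
  by rewrite /z => ->.
have z1 l : (l < d)%N -> z (l + d)%N = d%:R^-1 * (x2 (j * d + l)%N * x3 (k * d + l)%N).
  by move=> ld; rewrite /z ltnNge leq_addl /= ifT ?addnK//; lia.
have z2 l : (l < d)%N -> z (l + 2 * d)%N = d%:R^-1 * (x3 (k * d + l)%N * x1 (i * d + l)%N).
  by move=> ld; rewrite /z ifF ?ifF ?addnK//; lia.
split.
  rewrite sum3_ord /score mulr_sumr; apply: eq_bigr => l _.
  by rewrite z0// z1// z2// !mulrDr.
rewrite coefE /mono_exp /mono.
rewrite (prod3_ord _ (fun l => d%:R^-1 ^+ nth 0%N A l / (nth 0%N A l)`!%:R)) -!big_split /=.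
rewrite (prod3_ord _ (fun l => z l ^+ nth 0%N A l / (nth 0%N A l)`!%:R)).
apply: eq_bigr => l _; rewrite z0// z1// z2// mul0n addn0 mul1n !exprMn !exprD.
set a0 := nth _ _ l; set a1 := nth _ _ (l + d)%N; set a2 := nth _ _ (l + 2 * d)%N.
ring.
Qed.

(** The separation of variables read backwards: expanding the product of row sums and moving the sum
    over multi-indices inside leaves, for each pair [(j, k)], a multinomial expansion. *)
Lemma attention_approxE n G (y2 y3 : nat -> R) i :
  attention_approx n d G x1 x2 x3 y2 y3 i =
  \sum_(j < n) \sum_(k < n) taylor G (d%:R^-1 * score i j k) * (y2 j * y3 k).
Proof.
transitivity (\sum_(alpha <- multi (3 * d) G) \sum_(j < n) \sum_(k < n)
   coef R d (nth 0%N alpha) * mono d (nth 0%N alpha) x1 0 2 i *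
    mono d (nth 0%N alpha) x2 0 1 j * mono d (nth 0%N alpha) x3 1 2 k * (y2 j * y3 k)).
  apply: eq_bigr => A _; rewrite /term /mono_sum [X in X * _]mulr_sumr mulr_suml.
  apply: eq_bigr => j _; rewrite mulr_sumr; apply: eq_bigr => k _; ring.
rewrite exchange_big; apply: eq_bigr => j _; rewrite exchange_big; apply: eq_bigr => k _.
rewrite -mulr_suml; congr (_ * _).
(* The first half of [mono_exp_split] does not involve the multi-index, so [[::]] is a dummy. *)
have [E _] := mono_exp_split i j k [::]; rewrite /taylor -E.
transitivity (\sum_(alpha <- multi (3 * d) G) mono_exp (3 * d) (fun l : nat => d%:R^-1 *
      (if (l < d)%N then x1 (i * d + l)%N * x2 (j * d + l)%N
       else if (l < 2 * d)%N then x2 (j * d + (l - d))%N * x3 (k * d + (l - d))%N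
       else x3 (k * d + (l - 2 * d))%N * x1 (i * d + (l - 2 * d))%N)) alpha * 1).
  by apply: eq_bigr => A _; rewrite mulr1; have [_ ->] := mono_exp_split i j k A.
rewrite (multinomial_exp _ _ _ (fun=> 1)).
by apply: eq_bigr => m _; rewrite mulr1.
Qed.

End Approx.

(** With [S], [T] the exact sums, the difference is [((T' - T) - (T / S) (S' - S)) / S']. Both terms
    of the numerator are at most [eps * S * M], and [eps <= 1/2] gives [S' >= S / 2]; hence the
    factor 4. *)
Lemma weighted_mean_perturb (I : finType) (w w' v : I -> R) (eps M : R) :
  (forall i, 0 < w i) -> (0 < #|I|)%N -> eps <= 1 / 2 ->
  (forall i, `|w' i - w i| <= eps * w i) -> (forall i, `|v i| <= M) ->
  `|(\sum_i w' i * v i) / (\sum_i w' i) - (\sum_i w i * v i) / (\sum_i w i)| <= 4 * eps * M.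
Proof.
move=> w0 /card_gt0P[i0 _] e2 ww vM.
have M0 : 0 <= M by apply: le_trans (vM i0).
have e0 : 0 <= eps.
  by have := le_trans (normr_ge0 _) (ww i0); rewrite pmulr_lge0.
set S := \sum_i w i; set S' := \sum_i w' i.
set T := \sum_i w i * v i; set T' := \sum_i w' i * v i.
have S0 : 0 < S.
  by rewrite /S (bigD1 i0)//= ltr_pwDl// sumr_ge0// => i _; apply: ltW.
have SS : `|S' - S| <= eps * S.
  rewrite -sumrB (le_trans (ler_norm_sum _ _ _))// mulr_sumr ler_sum// => i _.
have TT : `|T' - T| <= eps * S * M.
  rewrite -sumrB (le_trans (ler_norm_sum _ _ _))// mulr_sumr mulr_suml ler_sum// => i _.
  by rewrite -mulrBl normrM ler_pM.
have TM : `|T| <= S * M.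
  rewrite (le_trans (ler_norm_sum _ _ _))// mulr_suml ler_sum// => i _.
  by rewrite normrM (ger0_norm (ltW (w0 i))) ler_wpM2l// ltW.
have S'2 : S <= 2 * S'.
  by move: SS; rewrite ler_distl => /andP[+ _]; nra.
have S'0 : 0 < S' by lra.
have -> : T' / S' - T / S = ((T' - T) - (T / S) * (S' - S)) / S'.
  by field; rewrite !gt_eqF.
rewrite normrM normfV (gtr0_norm S'0) ler_pdivrMr//.
apply: le_trans (ler_normB _ _) _.
have TSM : `|T / S| <= M by rewrite normrM normfV (gtr0_norm S0) ler_pdivrMr// mulrC.
have : `|T / S * (S' - S)| <= M * (eps * S) by rewrite normrM ler_pM.
have : 0 <= eps * M by rewrite mulr_ge0.
by move: TT; nra.
Qed.

Lemma expR1_le4 : expR 1 <= 4 :> R.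
Proof.
have h : expR (- 2^-1) >= 2^-1 :> R by apply: le_trans (expR_ge1Dx _); lra.
have e : expR 1 = (expR (- 2^-1))^-1 ^+ 2 :> R.
  by rewrite -expRN opprK -expRM_natl; congr expR; lra.
rewrite e (_ : 4 = 2 ^+ 2); last by ring.
by rewrite lerXn2r ?nnegrE ?invr_ge0 ?expR_ge0// -[leRHS]invrK lef_pV2 ?posrE ?expR_gt0.
Qed.

Lemma expR_le16 B N : B <= N%:R -> expR (2 * B) <= 16 ^+ N.
Proof.
move=> BN; apply: (@le_trans _ _ (expR ((2 * N)%N%:R * 1))).
  by rewrite ler_expR mulr1 natrM ler_pM2l.
rewrite expRM_natl exprM (_ : 16 = 4 ^+ 2); last by ring.
by apply: lerXn2r; rewrite ?nnegrE ?exprn_ge0 ?expR_ge0//;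
  apply: lerXn2r; rewrite ?nnegrE ?expR_ge0 ?expR1_le4.
Qed.

Lemma mx_cellsE n d (M : 'M[R]_(n, d)) (i : 'I_n) (l : 'I_d) : mx_cells M (i * d + l) = M i l.
Proof.
have d0 : (0 < d)%N by apply: leq_ltn_trans (ltn_ord l).
rewrite /mx_cells divnMDl// divn_small// addn0 modnMDl modn_small//.
by rewrite !valK.
Qed.

Lemma attention_approx_correct n d (Gamma gamma : R) (Q1 Q2 Q3 V2 V3 : 'M[R]_(n, d)) N G
    (x := fun M : 'M[R]_(n, d) => mx_cells M)
    (B := 3 * Gamma * Gamma)
    (C := 4 * (1 + \sum_(k < n * d) (x V2 k ^+ 2 + x V3 k ^+ 2)) * 16%:R ^+ N *
          (1 + 1 / gamma)) (i : 'I_n) (l : 'I_d) :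
  0 < gamma -> entries_le Gamma Q1 -> entries_le Gamma Q2 -> entries_le Gamma Q3 ->
  B <= N%:R -> error_bound C B G <= 1 ->
  `|attention_approx n d G (x Q1) (x Q2) (x Q3)
         (fun j => x V2 (j * d + l)%N) (fun j => x V3 (j * d + l)%N) i /
       attention_approx n d G (x Q1) (x Q2) (x Q3) (fun=> 1) (fun=> 1) i -
   strassen_att Q1 Q2 Q3 V2 V3 i l| <= gamma.
Proof.
move=> g0 q1 q2 q3 BN CG.
have d0 : (0 < d)%N by apply: leq_ltn_trans (ltn_ord l).
have B0 : 0 <= B by rewrite /B -mulrA mulr_ge0 // sqr_ge0.
have dotle (A A' : 'M[R]_(n, d)) a b : entries_le Gamma A -> entries_le Gamma A' ->
    `|\sum_(l < d) A a l * A' b l| <= d%:R * (Gamma * Gamma).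
  move=> hA hA'; apply: le_trans (ler_norm_sum _ _ _) _.
  rewrite -[X in X%:R]card_ord -sumr_const mulr_suml ler_sum// => c _.
  by rewrite mul1r normrM ler_pM.
pose t j k := d%:R^-1 * (row_dot Q1 Q2 i j + row_dot Q2 Q3 j k + row_dot Q3 Q1 k i).
(* Each of the three inner products is at most [d * Gamma^2], and [1/d] cancels the [d]. *)
have tB j k : `|t j k| <= B.
  rewrite /t normrM normfV normr_nat ler_pdivrMl ?ltr0n//.
  have := dotle _ _ i j q1 q2; have := dotle _ _ j k q2 q3; have := dotle _ _ k i q3 q1.
  rewrite -!/(row_dot _ _ _ _) => h1 h2 h3.
  apply: le_trans (ler_normD _ _) _.
  have := ler_normD (row_dot Q1 Q2 i j) (row_dot Q2 Q3 j k).
  by move: h1 h2 h3; rewrite /B /=; lra.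
have scoreE (j k : 'I_n) : d%:R^-1 * score d (x Q1) (x Q2) (x Q3) i j k = t j k.
  rewrite /t /score /row_dot -!big_split; congr (_ * _); apply: eq_bigr => c _.
  by rewrite /x !mx_cellsE.
set X := 1 + _ in C CG.
have X1 : 1 <= X by rewrite lerDl sumr_ge0// => k _; rewrite addr_ge0// sqr_ge0.
have vX (j k : 'I_n) : `|V2 j l * V3 k l| <= X.
  have sq (V : 'M[R]_(n, d)) (a : 'I_n) : V a l ^+ 2 <= \sum_(k < n * d) x V k ^+ 2.
    have h : (a * d + l < n * d)%N by have := ltn_ord a; have := ltn_ord l; nia.
    rewrite -mx_cellsE (bigD1 (Ordinal h))//= lerDl sumr_ge0// => c _.
    exact: sqr_ge0.
  have := sq V2 j; have := sq V3 k; rewrite /X big_split /=.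
  set s2 := \sum_(_ < _) _; set s3 := \sum_(_ < _) _ => h3 h2.
  have := sqr_ge0 (V2 j l - V3 k l); have := sqr_ge0 (V2 j l + V3 k l).
  by rewrite ler_norml; move: (sqr_ge0 (V2 j l)) (sqr_ge0 (V3 k l)) => *; apply/andP; split; nra.
pose eps := expR (2 * B) * (B ^+ G.+1 / (G.+1)`!%:R).
have f0 : 0 <= B ^+ G.+1 / (G.+1)`!%:R by rewrite divr_ge0 ?exprn_ge0.
have eps0 : 0 <= eps by rewrite mulr_ge0 ?expR_ge0.
have g1 : 0 < 1 / gamma by rewrite divr_gt0.
(* In [1 + 1 / gamma] the 1 yields [eps <= 1/4], as [X >= 1], which the perturbation lemma needs;
   [1 / gamma] yields the accuracy. *)
have epsle : 4 * X * eps * (1 + 1 / gamma) <= 1.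
  apply: le_trans CG; rewrite /error_bound /C -!(mulrA _ (B ^+ _)).
  have := expR_le16 BN; rewrite /eps; set u := expR _; set u' := 16 ^+ N => uu.
  rewrite (_ : _ * (u * _) * _ = (4 * X * (1 + 1 / gamma) * (B ^+ G.+1 / (G.+1)`!%:R)) * u); last by ring.
  rewrite (_ : 4 * X * u' * _ * _ = (4 * X * (1 + 1 / gamma) * (B ^+ G.+1 / (G.+1)`!%:R)) * u'); last by ring.
  rewrite ler_wpM2l// mulr_ge0// mulr_ge0//; last by rewrite addr_ge0// ltW.
  by rewrite mulr_ge0//; lra.
have tw j k : `|taylor G (t j k) - expR (t j k)| <= eps * expR (t j k).
  apply: le_trans (exp_taylor _ (tB j k)) _.
  rewrite /eps -/B; set f := _ / _.
  rewrite [leRHS](_ : _ = f * (expR (2 * B) * expR (t j k))); last by ring.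
  rewrite ler_wpM2l// -expRD ler_expR.
  by have := tB j k; rewrite ler_norml => /andP[+ _]; lra.
rewrite !attention_approxE /strassen_att mxE.
pose w (p : 'I_n * 'I_n) := expR (t p.1 p.2).
pose w' (p : 'I_n * 'I_n) := taylor G (t p.1 p.2).
pose v (p : 'I_n * 'I_n) := V2 p.1 l * V3 p.2 l.
have E1 : \sum_(j < n) \sum_(k < n) taylor G (d%:R^-1 * score d (x Q1) (x Q2) (x Q3) i j k) *
    (x V2 (j * d + l)%N * x V3 (k * d + l)%N) = \sum_p w' p * v p.
  rewrite (eq_bigr (fun j => \sum_(k < n) w' (j, k) * v (j, k))).
    by rewrite pair_bigA; apply: eq_bigr => -[].
  by move=> j _; apply: eq_bigr => k _; rewrite scoreE /x !mx_cellsE.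
have E2 : \sum_(j < n) \sum_(k < n) taylor G (d%:R^-1 * score d (x Q1) (x Q2) (x Q3) i j k) *
    (1 * 1) = \sum_p w' p.
  rewrite (eq_bigr (fun j => \sum_(k < n) w' (j, k))).
    by rewrite pair_bigA; apply: eq_bigr => -[].
  by move=> j _; apply: eq_bigr => k _; rewrite scoreE !mulr1.
have E3 : \sum_(j < n) \sum_(k < n) strassen_weight Q1 Q2 Q3 i j k * (V2 j l * V3 k l) =
    \sum_p w p * v p.
  by rewrite pair_bigA; apply: eq_bigr => -[].
have E4 : \sum_(j < n) \sum_(k < n) strassen_weight Q1 Q2 Q3 i j k = \sum_p w p.
  by rewrite pair_bigA; apply: eq_bigr => -[].
rewrite E1 E2 E3 E4.
have Xe : 0 <= X * eps by rewrite mulr_ge0//; lra.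
apply: le_trans (weighted_mean_perturb (eps := eps) (M := X) _ _ _ _ _) _.
- by move=> p; apply: expR_gt0.
- by apply/card_gt0P; exists (i, i).
- by nra.
- by move=> p; apply: tw.
- by move=> p; apply: vX.
have : 4 * X * eps * (1 / gamma) <= 1 by nra.
by rewrite mulrA mulr1 ler_pdivrMr// mul1r; lra.
Qed.

End Correctness.

(** * Asymptotics of the running time *)

(** Per multi-index: [d] columns, [n] rows, and a monomial in [O(d G)] steps, whence the cube. The
    successor of [size] absorbs the work outside the main loop. *)
Lemma program_time_le n d N G : (0 < n)%N -> (0 < d)%N ->
  (program_time n d N G <=
   200 * ((size (multi (3 * d) G)).+1 * (n * (d + G + N) ^ 3)))%N.
Proof.
move=> n0 d0; set r := size _; set q := (d + G + N)%N.
have q0 : (0 < q)%N by rewrite /q; lia.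
have dq : (d <= q)%N by rewrite /q; lia.
have Gq : (G <= q)%N by rewrite /q; lia.
have Nq : (N <= q)%N by rewrite /q; lia.
have [q1 q2] : (q <= q * q)%N /\ (q * q <= q * q * q)%N by split; nia.
have qq0 : (0 < q * q * q)%N by nia.
have mono_le : (mono_time d G <= 13 * (q * q))%N.
  rewrite /mono_time /for_time.
  have : (d * G <= q * q)%N by nia.
  by nia.
have column_le : (column_time n d G <= 104 * (n * (q * q)))%N.
  rewrite /column_time /for_time.
  have : (n * mono_time d G <= n * (13 * (q * q)))%N by nia.
  have : (n <= n * (q * q))%N by nia.
  by set m := mono_time d G; nia.
have nq3 : (q * q * q <= n * (q * q * q))%N by nia.
have term_le : (term_time n d G <= 132 * (n * (q * q * q)))%N.
  rewrite /term_time /for_time.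
  have : (d * column_time n d G <= 104 * (n * (q * q * q)))%N by nia.
  have : (d * G <= q * q)%N by nia.
  by set c := column_time n d G; nia.
have next_le : (next_time (3 * d) <= 17 * (n * (q * q * q)))%N.
  by rewrite /next_time; nia.
have loop_le : (loop_time n d G <= r * (150 * (n * (q * q * q))) + 1)%N.
  by rewrite /loop_time -/r leq_add2r leq_mul//; lia.
have nd : (n * d <= n * (q * q * q))%N by nia.
rewrite /program_time /for_time (_ : (q ^ 3 = q * q * q)%N); last by rewrite !expnS muln1 mulnA.
by move: loop_le; set t := loop_time n d G; nia.
Qed.

(** The estimate of [run_exec] with [M = n + d + 16], which bounds the input integers and the
    constants of the program. *)
Definition time_bound n d N G :=
  (program_time n d N G *
   (cweight attention_cmd * bitlen (n + d + 16 + program_time n d N G)))%N.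

Section Asymptotics.
Variable R : realType.

Lemma near_ln_ge (A : R) : \forall n \near \oo, A <= ln (n%:R : R).
Proof.
near=> n; have h : expR A <= n%:R :> R by near: n; exact: nbhs_infty_ger.
rewrite -(expRK A) ler_ln// ?posrE ?expR_gt0//.
by apply: lt_le_trans h; apply: expR_gt0.
Unshelve. all: by end_near. Qed.

(** With [L = ln n], a single term [(eta L)^(k+1) / (k+1)!] of the exponential series already
    exceeds [A L^k] once [L] is large. *)
Lemma near_polyln_le (A eta : R) k : 0 < eta ->
  \forall n \near \oo, A * ln (n%:R : R) ^+ k <= expR (eta * ln (n%:R : R)).
Proof.
move=> eta0; near=> n.
have L0 : 0 <= ln (n%:R : R) by near: n; exact: near_ln_ge.
have LA : A * (k.+1)`!%:R / eta ^+ k.+1 <= ln (n%:R : R).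
  by near: n; exact: near_ln_ge.
set L := ln _ in L0 LA *.
have f0 : 0 < (k.+1)`!%:R :> R by rewrite ltr0n fact_gt0.
apply: le_trans (expR_ge1Dxn k _); last by rewrite mulr_ge0// ltW.
apply: (@le_trans _ _ ((eta * L) ^+ k.+1 / (k.+1)`!%:R)); last by rewrite lerDr.
rewrite ler_pdivlMr// exprMn [L ^+ k.+1]exprS.
move: LA; rewrite ler_pdivrMr ?exprn_gt0// => LA.
have := ler_wpM2r (exprn_ge0 k L0) LA.
rewrite mulrAC => /le_trans; apply.
by rewrite [leLHS](_ : _ = eta ^+ k.+1 * (L * L ^+ k))//; ring.
Unshelve. all: by end_near. Qed.

Lemma multi_sumn D G s : s \in multi D G -> (sumn s <= G)%N.
Proof.
elim: D s => [|D IH] s; first by rewrite inE => /eqP->.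
rewrite [multi _ _]/multi -/multi => /flattenP[r /mapP[t tm ->] /mapP[a ha ->]].
by move: ha (IH _ tm); rewrite mem_iota [sumn (_ :: _)]/=; lia.
Qed.

(** Give each multi-index the weight [x ^ |alpha|], which is at least [x ^ G]; the total weight is
    at most a product of [D] geometric series. *)
Lemma size_multi_le D G (x : R) : 0 < x < 1 ->
  (size (multi D G))%:R * x ^+ G <= (1 - x)^-1 ^+ D.
Proof.
move=> /andP[x0 x1].
have x1' : 0 < 1 - x by rewrite subr_gt0.
apply: (@le_trans _ _ (\sum_(s <- multi D G) x ^+ sumn s)).
  rewrite -sum1_size natr_sum mulr_suml big_seq [leRHS]big_seq.
  apply: ler_sum => s sm; rewrite mul1r ler_wiXn2l ?ltW//.
  exact: multi_sumn sm.
elim: D => [|D IH]; first by rewrite big_seq1 !expr0.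
rewrite sum_multi exprSr; apply: le_trans (ler_wpM2r _ IH); last by rewrite invr_ge0 ltW.
rewrite mulr_suml; apply: ler_sum => s _.
rewrite (eq_bigr (fun a : 'I__ => x ^+ sumn s * x ^+ a)); last first.
  by move=> a _; rewrite /= addnC exprD.
rewrite -mulr_sumr ler_wpM2l ?exprn_ge0 ?(ltW x0)//.
rewrite -[leRHS]mulr1 ler_pdivlMl//.
have := subrX1 x (G - sumn s).+1; have := exprn_ge0 (G - sumn s).+1 (ltW x0).
by set S := \sum_(_ < _) _; lra.
Qed.

Lemma degree_lt (C B : R) g z : 0 < C -> 0 <= B -> 1 < error_bound C B g ->
  z * g.+1%:R < ln C + B * expR z.
Proof.
move=> C0 B0; rewrite /error_bound => h.
have f0 : 0 < (g.+1)`!%:R :> R by rewrite ltr0n fact_gt0.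
have le : B ^+ g.+1 / (g.+1)`!%:R <= expR (B * expR z) * expR (- (z * g.+1%:R)).
  have := expR_ge1Dxn g (mulr_ge0 B0 (expR_ge0 z)).
  rewrite exprMn -expRM_natr expRN ler_pdivlMr ?expR_gt0// => h'.
  by apply: le_trans h'; rewrite mulrAC; lra.
have : 1 < C * (expR (B * expR z) * expR (- (z * g.+1%:R))).
  by apply: lt_le_trans h _; rewrite -mulrA ler_pM2l.
rewrite -{1}[C]lnK ?posrE// -!expRD expR_gt1; lra.
Qed.

Lemma bitlen_le_ln m : (0 < m)%N -> (bitlen m)%:R <= 2 * ln (m%:R : R) + 1.
Proof.
move=> m0; rewrite /bitlen -natr1 lerD2r.
have h : expR (2^-1) <= 2 :> R.
  have := expR_ge1Dx (- 2^-1 : R); rewrite expRN => h.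
  by rewrite -[leRHS]invrK -[leLHS]invrK lef_pV2 ?posrE ?invr_gt0 ?expR_gt0//; lra.
have : (2 ^ trunc_log 2 m)%:R <= m%:R :> R by rewrite ler_nat trunc_logP.
rewrite natrX => h2.
have : expR (2^-1 * (trunc_log 2 m)%:R) <= m%:R :> R.
  apply: le_trans h2; rewrite expRM_natr lerXn2r ?nnegrE ?expR_ge0//.
rewrite -ler_ln ?posrE ?expR_gt0 ?ltr0n// expRK; lra.
Qed.

(** The order of choices matters: [delta] and the constant in [d = O(log n)] fix [x], then
    [z = - ln x], and only then is [G = o(log n)] used, at rate [delta / (4 z)], so that
    [x ^- g <= n ^ (delta / 4)]. The bound is uniform in [g], as the degree reached depends on the
    values. *)
Lemma near_time_bound (d N G : nat -> nat) (C1 : R) :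
  (forall n, (0 < d n)%N) ->
  (\forall n \near \oo, (d n)%:R <= C1 * ln (n%:R : R)) ->
  (\forall n \near \oo, (N n)%:R <= ln (n%:R : R)) ->
  (forall eta, 0 < eta -> \forall n \near \oo, (G n)%:R <= eta * ln (n%:R : R)) ->
  forall delta, 0 < delta -> \forall n \near \oo, forall g, (g <= G n)%N ->
    (time_bound n (d n) (N n) g)%:R <= expR ((1 + delta) * ln (n%:R : R)).
Proof.
move=> d0 dC1 N1 Geta delta0 delta_gt0.
(* The cap at 1 yields the crude bound [T <= n^2], with which the bit length is controlled. *)
pose delta := Num.min 1 delta0.
have dd : 0 < delta <= 1 by rewrite /delta lt_min ltr01 delta_gt0 ge_min lexx.
have C1' : 0 < Num.max 1 C1 by rewrite lt_max ltr01.
set C := Num.max 1 C1 in C1'.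
(* chosen so that [(1 - x) ^- (3 d) <= n ^ (delta / 4)] *)
pose x := 1 - expR (- (delta / (12 * C))).
have xe : 0 < delta / (12 * C) by rewrite divr_gt0//; lra.
have x01 : 0 < x < 1.
  by rewrite /x subr_gt0 expR_lt1 oppr_lt0 xe/= ltrBlDr ltrDl expR_gt0.
have [x0 x1] := andP x01.
pose z := - ln x.
have z0 : 0 < z by rewrite oppr_gt0 ln_lt0.
(* [A], and [W] below, are kept opaque behind an equation. *)
have [A AE] : {A : R | A = 400 * (C + 2) ^+ 3} by exists (400 * (C + 2) ^+ 3).
have A0 : 0 <= A.
  rewrite AE; apply: mulr_ge0; first exact: ler0n.
  by apply: exprn_ge0; apply: addr_ge0; [exact: ltW|exact: ler0n].
have [W WE] : {W : R | W = (cweight attention_cmd)%:R} by exists (cweight attention_cmd)%:R.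
pose Lf n : R := ln (n%:R : R).
near=> n => g gG.
have L1 : 1 <= Lf n by near: n; exact: near_ln_ge.
have n0 : (0 < n)%N by rewrite lt0n; apply: contraTneq L1 => ->; rewrite /Lf ln0//; lra.
have nL : expR (Lf n) = n%:R by rewrite /Lf lnK// posrE ltr0n.
have dL : (d n)%:R <= C * Lf n.
  apply: (@le_trans _ _ (C1 * Lf n)); first by near: n.
  by rewrite ler_wpM2r ?le_max ?lexx ?orbT//; lra.
have NL : (N n)%:R <= Lf n by near: n.
have GL : (G n)%:R <= delta / (4 * z) * Lf n.
  by near: n; apply: Geta; rewrite divr_gt0 ?mulr_gt0//; lra.
have GL1 : (G n)%:R <= 1 * Lf n by near: n; apply: Geta.
have gGR : g%:R <= (G n)%:R :> R by rewrite ler_nat.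
have g0 : 0 <= g%:R :> R by [].
set r := size (multi (3 * d n) g).
have rle : r%:R <= expR (delta / 2 * Lf n).
  have := size_multi_le (3 * d n) g x01; rewrite -/r => h.
  have e1 : (1 - x)^-1 ^+ (3 * d n) <= expR (delta / 4 * Lf n).
    rewrite /x opprB addrC subrK -expRN opprK -expRM_natl ler_expR natrM.
    rewrite mulrA -[leRHS]mulrC.
    apply: (@le_trans _ _ (3 * (C * Lf n) * delta / (12 * C))).
      rewrite ler_pM2r ?invr_gt0; last by lra.
      by rewrite ler_pM2r; lra.
    by rewrite le_eqVlt; apply/orP; left; apply/eqP; field; rewrite lt0r_neq0.
  have e2 : expR (- (delta / 4 * Lf n)) <= x ^+ g.
    rewrite -[x in leRHS]lnK ?posrE// -expRM_natr ler_expR -[ln x]opprK -/z mulNr lerN2.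
    apply: le_trans (ler_wpM2l (ltW z0) (le_trans gGR GL)) _.
    by rewrite le_eqVlt; apply/orP; left; apply/eqP; field; rewrite lt0r_neq0.
  have : r%:R * expR (- (delta / 4 * Lf n)) <= expR (delta / 4 * Lf n).
    apply: le_trans (le_trans h e1); rewrite ler_wpM2l//.
  rewrite expRN ler_pdivrMr ?expR_gt0// -expRD => /le_trans; apply.
  by rewrite ler_expR; lra.
have U1 : (program_time n (d n) (N n) g)%:R <= A * Lf n ^+ 3 * expR (delta / 2 * Lf n) * n%:R.
  have := program_time_le (N n) g n0 (d0 n); rewrite -(ler_nat R) => /le_trans; apply.
  rewrite -/r 3!natrM natrX !natrD -natr1 AE.
  set q := _ + _ + _.
  have q0 : 0 <= q by rewrite !addr_ge0.
  have qL : q <= (C + 2) * Lf n by rewrite /q; lra.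
  have q3 : q ^+ 3 <= (C + 2) ^+ 3 * Lf n ^+ 3.
    by rewrite -exprMn lerXn2r ?nnegrE// (le_trans q0).
  have E1 : 1 <= expR (delta / 2 * Lf n).
    by rewrite -expR0 ler_expR mulr_ge0 ?divr_ge0//; lra.
  have r2 : r%:R + 1 <= 2 * expR (delta / 2 * Lf n) by lra.
  have h : (r%:R + 1) * (n%:R * q ^+ 3) <=
     2 * expR (delta / 2 * Lf n) * (n%:R * ((C + 2) ^+ 3 * Lf n ^+ 3)).
    by rewrite ler_pM ?ler_wpM2l ?mulr_ge0 ?exprn_ge0 ?addr_ge0.
  by move: h; set E := expR _; lra.
rewrite /time_bound; move: (program_time _ _ _ _) U1 => T U1.
have U2 : T%:R <= expR (2 * Lf n).
  apply: le_trans U1 _.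
  have : A * Lf n ^+ 3 <= expR (2^-1 * Lf n) by near: n; exact: near_polyln_le.
  set E := expR (2^-1 * Lf n) => h.
  apply: (@le_trans _ _ (E * expR (2^-1 * Lf n) * n%:R)).
    have EE : expR (delta / 2 * Lf n) <= E by rewrite ler_expR; nra.
    have AL : 0 <= A * Lf n ^+ 3 by rewrite mulr_ge0 ?exprn_ge0// (le_trans _ L1).
    by rewrite ler_wpM2r// ler_pM ?expR_ge0.
  by rewrite -nL -!expRD ler_expR; lra.
have Lb : (bitlen (n + d n + 16 + T))%:R <= 7 * Lf n.
  apply: le_trans (bitlen_le_ln _) _; first by rewrite !addn_gt0 n0.
  have h : (n + d n + 16 + T)%:R <= expR (3 * Lf n).
    rewrite !natrD -nL.
    have h1 : (C + 16) * Lf n ^+ 1 <= expR (2 * Lf n) by near: n; exact: near_polyln_le.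
    have h2 : expR (Lf n) <= expR (2 * Lf n) by rewrite ler_expR; lra.
    have h3 : 3 * expR (2 * Lf n) <= expR (3 * Lf n).
      rewrite [X in _ <= expR X](_ : _ = Lf n + 2 * Lf n); last by ring.
      rewrite expRD ler_pM2r ?expR_gt0//.
      have : 3 * Lf n ^+ 0 <= expR (1 * Lf n) by near: n; exact: near_polyln_le.
      by rewrite expr0 mul1r mulr1.
    by move: h1; rewrite expr1; lra.
  have : ln ((n + d n + 16 + T)%:R : R) <= 3 * Lf n.
    by rewrite -[leRHS]expRK ler_ln ?posrE ?expR_gt0 ?ltr0n// !addn_gt0 n0.
  by lra.
(* Three logarithms come from the cube and one from the bit length; the multi-indices have used
   [delta / 2], and this takes the other half. *)
have fin : A * W * 7 * Lf n ^+ 4 <= expR (delta / 2 * Lf n).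
  by near: n; apply: near_polyln_le; lra.
rewrite 2!natrM -WE.
have W0 : 0 <= W by rewrite WE.
apply: (@le_trans _ _ (A * Lf n ^+ 3 * expR (delta / 2 * Lf n) * n%:R * (W * (7 * Lf n)))).
  by rewrite ler_pM ?mulr_ge0 ?ler_wpM2l.
apply: (@le_trans _ _ (expR (delta / 2 * Lf n) * expR (delta / 2 * Lf n) * n%:R)).
  rewrite [leLHS](_ : _ = (A * W * 7 * Lf n ^+ 4) * expR (delta / 2 * Lf n) * n%:R); last by ring.
  by rewrite ler_wpM2r// ler_wpM2r ?expR_ge0.
rewrite -nL -!expRD ler_expR.
have : delta <= delta0 by rewrite /delta ge_min lexx orbT.
by rewrite expRK => h; have := ler_wpM2r (le_trans ler01 L1) h; lra.
Unshelve. all: by end_near. Qed.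

End Asymptotics.

(** * The parameters as functions of [n], and the exponent [1 + o(1)] *)

Section Assembly.
Variable R : realType.

Lemma exists_ceil (B : R) : 0 <= B ->
  exists N : nat, B <= N%:R /\ forall m, (m < N)%N -> m%:R < B.
Proof.
move=> B0; have ex : exists N : nat, B <= N%:R.
  by exists (Num.bound B); apply/ltW/archi_boundP.
have [N BN minN] := ex_minnP ex; exists N; split=> // m mN.
by rewrite ltNge; apply/negP => /minN; rewrite leqNgt mN.
Qed.

Lemma exists_degree (C B : R) : 0 < C -> 0 <= B ->
  exists G, error_bound C B G <= 1 /\ forall g, (g < G)%N -> 1 < error_bound C B g.
Proof.
move=> C0 B0; have ex : exists G, error_bound C B G <= 1.
  (* By [degree_lt] with [z = 1], failure at degree [g] forces [g + 1 < ln C + B * expR 1], so any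
     degree beyond [y] works. *)
  pose y := `|ln C + B * expR 1|; exists (Num.bound y); rewrite leNgt.
  apply/negP => /(degree_lt 1 C0 B0); rewrite mul1r ltNge => /negP; apply.
  apply: le_trans (ler_norm _) _; apply/ltW/(lt_trans (archi_boundP (normr_ge0 _))).
  by rewrite ltr_nat.
have [G CG minG] := ex_minnP ex; exists G; split=> // g gG.
by rewrite ltNge; apply/negP => /minG; rewrite leqNgt gG.
Qed.

Lemma error_bound_le (C C' B : R) g : 0 <= B -> C <= C' ->
  error_bound C B g <= error_bound C' B g.
Proof.
move=> B0 CC'; rewrite /error_bound ler_wpM2r ?invr_ge0//.
by rewrite ler_wpM2r// exprn_ge0.
Qed.

Lemma mx_cells_le n d (b : R) (M : 'M[R]_(n, d)) k : 0 <= b -> entries_le b M ->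
  `|mx_cells M k| <= b.
Proof.
move=> b0 Mb; rewrite /mx_cells.
case: insubP => [i _ _|_]; last by rewrite normr0.
by case: insubP => [j _ _|_]; rewrite ?normr0.
Qed.

Definition error_constant (N : nat) (v gamma : R) : R :=
  4 * (1 + v) * 16 ^+ N * (1 + 1 / gamma).

Lemma error_constant_gt0 N v gamma : 0 <= v -> 0 < gamma -> 0 < error_constant N v gamma.
Proof.
move=> v0 g0; rewrite /error_constant !mulr_gt0 ?exprn_gt0//; first by rewrite ltr_pwDl.
by rewrite ltr_pwDl// divr_ge0// ltW.
Qed.

Definition value_bound kappa n d : R := (n * d)%:R * (2 * (n%:R ^+ kappa) ^+ 2).

Lemma value_bound_ge kappa n d (V2 V3 : 'M[R]_(n, d)) :
  entries_le (n%:R ^+ kappa) V2 -> entries_le (n%:R ^+ kappa) V3 ->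
  \sum_(k < n * d) (mx_cells V2 k ^+ 2 + mx_cells V3 k ^+ 2) <= value_bound kappa n d.
Proof.
move=> h2 h3; rewrite /value_bound -[X in X%:R]card_ord -sumr_const mulr_suml.
apply: ler_sum => k _; rewrite mul1r.
have b0 : 0 <= n%:R ^+ kappa :> R by rewrite exprn_ge0.
have sq (M : 'M[R]_(n, d)) : entries_le (n%:R ^+ kappa) M ->
    mx_cells M k ^+ 2 <= (n%:R ^+ kappa) ^+ 2.
  by move=> /(mx_cells_le k b0) h; rewrite -real_normK ?num_real// lerXn2r ?nnegrE.
by have := sq _ h2; have := sq _ h3; lra.
Qed.

Variables (d N G : nat -> nat) (Gamma gamma : nat -> R) (kappa : nat).
Hypothesis d_gt0 : forall n, (0 < d n)%N.
Hypothesis dO : (fun n => (d n)%:R : R) =O_\oo (fun n => ln (n%:R : R)).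
Hypothesis Gammao : Gamma =o_\oo (fun n => Num.sqrt (ln (n%:R : R))).
Hypothesis gamma_gt0 : forall n, 0 < gamma n.
Variable c : nat.
Hypothesis gammaO : (fun n => (gamma n)^-1%R) =O_\oo (fun n => (n%:R : R) ^+ c).

Let B n := 3 * Gamma n * Gamma n.
Hypothesis Nmin : forall n, B n <= (N n)%:R /\ forall m, (m < N n)%N -> m%:R < B n.
Let C n := error_constant (N n) (value_bound kappa n (d n)) (gamma n).
Hypothesis Gmin : forall n, error_bound (C n) (B n) (G n) <= 1 /\
  forall g, (g < G n)%N -> 1 < error_bound (C n) (B n) g.

Let B_ge0 n : 0 <= B n. Proof. by rewrite /B -mulrA mulr_ge0// sqr_ge0. Qed.

Lemma near_dimension :
  exists2 C1 : R, 0 < C1 & \forall n \near \oo, (d n)%:R <= C1 * ln (n%:R : R).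
Proof.
have /eqO_exP[k k0 H] := dO; exists k => //; near=> n.
have L0 : 0 <= ln (n%:R : R) by near: n; exact: near_ln_ge.
have : `|(d n)%:R| <= k * `|ln (n%:R : R)| by near: n.
by rewrite normr_nat (ger0_norm L0).
Unshelve. all: by end_near. Qed.

Lemma near_exponent (eta : R) : 0 < eta ->
  \forall n \near \oo, B n <= eta * ln (n%:R : R).
Proof.
move=> eta0; have e0 : 0 < Num.sqrt (eta / 3) by rewrite sqrtr_gt0 divr_gt0.
have /eqoP/(_ _ e0) H := Gammao; near=> n.
have L0 : 0 <= ln (n%:R : R) by near: n; exact: near_ln_ge.
have h : `|Gamma n| <= Num.sqrt (eta / 3) * `|Num.sqrt (ln (n%:R : R))| by near: n.
rewrite (ger0_norm (sqrtr_ge0 _)) in h.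
have : `|Gamma n| ^+ 2 <= (Num.sqrt (eta / 3) * Num.sqrt (ln n%:R)) ^+ 2.
  by rewrite lerXn2r ?nnegrE// mulr_ge0 ?sqrtr_ge0.
rewrite real_normK ?num_real// exprMn !sqr_sqrtr//; last by rewrite divr_ge0// ltW.
by rewrite /B -mulrA -expr2; lra.
Unshelve. all: by end_near. Qed.

(** By minimality [N n - 1 < B n], and eventually [B n <= ln n / 2] with [ln n >= 2]. *)
Lemma near_ceil : \forall n \near \oo, (N n)%:R <= ln (n%:R : R).
Proof.
near=> n.
have L2 : 2 <= ln (n%:R : R) by near: n; exact: near_ln_ge.
have h2 : 0 < 2^-1 :> R by [].
have h : B n <= 2^-1 * ln (n%:R : R) by near: n; exact: near_exponent.
have [_ NB] := Nmin n; case e : (N n) => [|m]; first by lra.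
have := NB m; rewrite e ltnSn => /(_ isT); rewrite -natr1; lra.
Unshelve. all: by end_near. Qed.

(** An exponent of [n] for each factor of [C n]: 1 for the 4, [2 + 2 kappa] for the values, 4 for
    [16 ^ N] (as [16 <= expR 4] and [N <= ln n]), and [c + 1] for [1 + 1 / gamma]. *)
Let K : R := (8 + 2 * kappa + c)%:R.

Lemma near_constant : \forall n \near \oo, ln (C n) <= K * ln (n%:R : R).
Proof.
have [C1 C10 dC1] := near_dimension.
have /eqO_exP[C3 C30 gC3] := gammaO.
have e4 : 16 <= expR 4 :> R.
  have e1 : 2 <= expR 1 :> R by apply: le_trans (expR_ge1Dx 1); lra.
  have -> : expR 4 = expR 1 ^+ 4 :> R by rewrite -expRM_natl mulr1.
  rewrite (_ : 16 = 2 ^+ 4); last by ring.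
  by rewrite lerXn2r ?nnegrE// expR_ge0.
near=> n.
have L1 : 1 <= ln (n%:R : R) by near: n; exact: near_ln_ge.
have n0 : (0 < n)%N by rewrite lt0n; apply: contraTneq L1 => ->; rewrite ln0//; lra.
have h4 : 4 * ln (n%:R : R) ^+ 0 <= expR (1 * ln (n%:R : R)).
  by near: n; exact: near_polyln_le.
have hd : (d n)%:R <= C1 * ln (n%:R : R) by near: n.
have hL : (1 + 2 * C1) * ln (n%:R : R) ^+ 1 <= expR (1 * ln (n%:R : R)).
  by near: n; exact: near_polyln_le.
have hN : (N n)%:R <= ln (n%:R : R) by near: n; exact: near_ceil.
have hg : `|(gamma n)^-1| <= C3 * `|n%:R ^+ c| by near: n.
have h3 : (1 + C3) * ln (n%:R : R) ^+ 0 <= expR (1 * ln (n%:R : R)).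
  by near: n; exact: near_polyln_le.
have nL : n%:R = expR (ln (n%:R : R)) by rewrite lnK// posrE ltr0n.
move: L1 h4 hd hL hN hg h3 nL; set L := ln _ => L1 h4 hd hL hN hg h3 nL.
rewrite ger0_norm ?invr_ge0 ?(ltW (gamma_gt0 n))// ger0_norm ?exprn_ge0// in hg.
rewrite !expr0 !expr1 ?mul1r ?mulr1 in h4 hL h3.
have nX k : n%:R ^+ k = expR (k%:R * L) by rewrite nL expRM_natl.
have V : 1 + value_bound kappa n (d n) <= expR ((2 + 2 * kappa)%:R * L).
  rewrite /value_bound natrM nL -nL -exprM nX.
  have -> : (2 + 2 * kappa)%:R * L = L + (L + (kappa * 2)%:R * L).
    by rewrite natrD !natrM; ring.
  rewrite !expRD -nL.
  have E1 : 1 <= n%:R * expR ((kappa * 2)%:R * L).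
    by rewrite nL -expRD -expR0 ler_expR addr_ge0 ?mulr_ge0//; lra.
  apply: (@le_trans _ _ ((1 + 2 * C1) * L * (n%:R * expR ((kappa * 2)%:R * L)))); last first.
    by rewrite ler_wpM2r//; lra.
  move: E1; set E := n%:R * _ => E1.
  rewrite [_ * _ * _](_ : _ = 2 * (d n)%:R * E); last by rewrite /E; ring.
  have : (d n)%:R * E <= C1 * L * E by rewrite ler_wpM2r//; lra.
  have : E <= L * E by rewrite ler_peMl//; lra.
  by lra.
have P : 16 ^+ N n <= expR (4 * L).
  apply: (@le_trans _ _ (expR 4 ^+ N n)); first by rewrite lerXn2r ?nnegrE ?expR_ge0.
  by rewrite -expRM_natr ler_expR; lra.
have Q : 1 + 1 / gamma n <= expR (c.+1%:R * L).
  rewrite div1r -natr1 mulrDl mul1r expRD -nX.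
  have E1 : 1 <= n%:R ^+ c :> R by rewrite exprn_ege1// ler1n.
  apply: (@le_trans _ _ (n%:R ^+ c * (1 + C3))); first by lra.
  by rewrite ler_wpM2l// (le_trans _ E1).
have v0 : 0 <= value_bound kappa n (d n) by rewrite !mulr_ge0// !exprn_ge0.
have C0 : 0 < C n by apply: error_constant_gt0.
rewrite -[leRHS]expRK ler_ln ?posrE ?expR_gt0//.
have -> : K * L = L + (2 + 2 * kappa)%:R * L + 4 * L + c.+1%:R * L.
  by rewrite /K -natr1 !natrD; ring.
have g1 : 0 <= 1 / gamma n by rewrite divr_ge0// ltW.
rewrite !expRD /C /error_constant.
have p1 : 0 <= 1 + value_bound kappa n (d n) by rewrite addr_ge0.
have p2 : 0 <= 16 ^+ N n :> R by rewrite exprn_ge0.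
have p3 : 0 <= 4 * (1 + value_bound kappa n (d n)) by apply: mulr_ge0.
have p4 : 0 <= 4 * (1 + value_bound kappa n (d n)) * 16 ^+ N n by apply: mulr_ge0.
have p5 : 0 <= 1 + 1 / gamma n by apply: addr_ge0.
by rewrite ler_pM// ler_pM// ler_pM.
Unshelve. all: by end_near. Qed.

Lemma near_degree (eta : R) : 0 < eta ->
  \forall n \near \oo, (G n)%:R <= eta * ln (n%:R : R).
Proof.
move=> eta0.
have K0 : 0 < K by rewrite ltr0n.
(* In [degree_lt] both [ln C] and [B * expR z] will be at most [K ln n], the latter since
   [B = o(log n)] beats the constant [expR z]. Dividing [2 K ln n] by this [z] leaves [eta ln n]. *)
pose z := 2 * K / eta; have z0 : 0 < z by rewrite divr_gt0// mulr_gt0.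
have e0 : 0 < K * expR (- z) by rewrite mulr_gt0// expR_gt0.
near=> n.
have L0 : 0 <= ln (n%:R : R) by near: n; exact: near_ln_ge.
have hC : ln (C n) <= K * ln (n%:R : R) by near: n; exact: near_constant.
have hB : B n <= K * expR (- z) * ln (n%:R : R) by near: n; exact: near_exponent.
have [_ Gm] := Gmin n; case e : (G n) => [|g]; first by rewrite mulr_ge0// ltW.
have v0 : 0 <= value_bound kappa n (d n) by rewrite !mulr_ge0// !exprn_ge0.
have C0 : 0 < C n by apply: error_constant_gt0.
have := Gm g; rewrite e ltnSn => /(_ isT) /(degree_lt z C0 (B_ge0 n)) h.
have hB' : B n * expR z <= K * ln (n%:R : R).
  apply: le_trans (ler_wpM2r (expR_ge0 z) hB) _.
  rewrite [leLHS](_ : _ = K * ln n%:R * (expR (- z) * expR z)); last by ring.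
  by rewrite -expRD addNr expR0 mulr1.
rewrite -(ler_pM2l z0) mulrA (_ : z * eta = 2 * K); first by lra.
by rewrite /z divfK// gt_eqF.
Unshelve. all: by end_near. Qed.

(** A maximum over all admissible degrees makes monotonicity of [time_bound] in the degree
    unnecessary. *)
Definition worst_time n := \max_(g < (G n).+1) time_bound n (d n) (N n) g.

(** Solves [worst_time n = n ^ (1 + excess n)], so that the content lies in the convergence to 0.
    Clipping at 0 makes an upper bound on the time sufficient for it. *)
Definition excess n : R := Num.max 0 (ln (worst_time n)%:R / ln n%:R - 1).

Lemma excess_cvg : excess n @[n --> \oo] --> (0 : R).
Proof.
have [C1 C10 dC1] := near_dimension.
apply/cvgrPdist_le => eps eps0; near=> n.
have L1 : 1 <= ln (n%:R : R) by near: n; exact: near_ln_ge.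
have H : forall g, (g <= G n)%N ->
    (time_bound n (d n) (N n) g)%:R <= expR ((1 + eps) * ln (n%:R : R)).
  by near: n; exact: (near_time_bound d_gt0 dC1 near_ceil near_degree).
have T : (worst_time n)%:R <= expR ((1 + eps) * ln (n%:R : R)).
  apply: (big_ind (fun m : nat => m%:R <= expR ((1 + eps) * ln (n%:R : R)))).
  - exact: expR_ge0.
  - by move=> a b; rewrite /maxn; case: ifP.
  - by move=> g _; apply: H; rewrite -ltnS.
rewrite sub0r normrN /excess ger0_norm ?le_max ?lexx// ge_max ltW//=.
rewrite lerBlDr ler_pdivrMr; last by lra.
case: (posnP (worst_time n)) => [->|t0].
  by rewrite ln0// mulr_ge0 ?addr_ge0//; lra.
by rewrite addrC -ler_expR lnK ?posrE ?ltr0n.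
Unshelve. all: by end_near. Qed.

Lemma worst_timeO : (fun n => (worst_time n)%:R : R) =O_\oo (fun n => (n%:R : R) `^ (1 + excess n)).
Proof.
apply/eqO_exP; exists 1 => //; near=> n.
have L1 : 1 <= ln (n%:R : R) by near: n; exact: near_ln_ge.
have n0 : (0 < n)%N by rewrite lt0n; apply: contraTneq L1 => ->; rewrite ln0//; lra.
rewrite mul1r normr_nat ger0_norm ?powR_ge0//.
case: (posnP (worst_time n)) => [->|t0]; first exact: powR_ge0.
rewrite /powR gt_eqF ?ltr0n// -[leLHS]lnK ?posrE ?ltr0n// ler_expR.
rewrite -ler_pdivrMr; last by lra.
have : ln (worst_time n)%:R / ln n%:R - 1 <= excess n by rewrite /excess le_max lexx orbT.
by lra.
Unshelve. all: by end_near. Qed.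

Lemma attention_exec n (Q1 Q2 Q3 V2 V3 : 'M[R]_(n, d n)) : (0 < n)%N ->
  entries_le (Gamma n) Q1 -> entries_le (Gamma n) Q2 -> entries_le (Gamma n) Q3 ->
  exists (t : nat) (s : state R),
    [/\ exec attention_cmd (input (Gamma n) (gamma n) Q1 Q2 Q3 V2 V3) t s,
        forall (i : 'I_n) (j : 'I_(d n)),
          `|output n (d n) s i j - strassen_att Q1 Q2 Q3 V2 V3 i j| <= gamma n &
        entries_le (n%:R ^+ kappa) V2 -> entries_le (n%:R ^+ kappa) V3 ->
        (t <= worst_time n)%N].
Proof.
move=> n0 q1 q2 q3; have [BN NB] := Nmin n.
set v := \sum_(k < n * d n) (mx_cells V2 k ^+ 2 + mx_cells V3 k ^+ 2).
have v0 : 0 <= v by apply: sumr_ge0 => k _; rewrite addr_ge0// sqr_ge0.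
have C0 := error_constant_gt0 (N n) v0 (gamma_gt0 n).
have [g [Cg gC]] := exists_degree C0 (B_ge0 n).
have [u [s [hrun uU hs]]] := @runs_attention R n (d n) (Gamma n) (gamma n) Q1 Q2 Q3 V2 V3
  (N n) g BN NB Cg gC.
have M1 : (1 < n + d n + 16)%N by lia.
have ib : ibounded (n + d n + 16) (input (Gamma n) (gamma n) Q1 Q2 Q3 V2 V3).
  move=> a k; rewrite /input /=; case: (a == 0%N) => //.
  by case: k => [|[|k]] /=; rewrite ?nth_nil; lia.
have kb : all (leq^~ (n + d n + 16)%N) (cconsts attention_cmd).
  have : all (leq^~ 16%N) (cconsts attention_cmd) by [].
  by apply: sub_all => m /leq_trans; apply; rewrite leq_addl.
have [_ [t ht tt]] := run_exec hrun M1 ib attention_slow kb.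
exists t, s; split=> //.
  move=> i j; rewrite mxE hs//.
  exact: (attention_approx_correct (N := N n) i j (gamma_gt0 n) q1 q2 q3 BN Cg).
(* The actual error constant is at most [C n], so the estimate already holds at degree [G n], and
   the least such degree [g] cannot exceed it. *)
move=> h2 h3; have gG : (g < (G n).+1)%N.
  rewrite ltnS leqNgt; apply/negP => /gC; rewrite ltNge => /negP; apply.
  apply: le_trans (proj1 (Gmin n)); apply: error_bound_le => //.
  rewrite /C /error_constant.
  rewrite ler_wpM2r//; first by rewrite addr_ge0// divr_ge0// ltW.
  rewrite ler_wpM2r ?exprn_ge0// ler_wpM2l// lerD2l.
  exact: value_bound_ge.
apply: leq_trans tt _.
apply: (@leq_trans (time_bound n (d n) (N n) g)).
  by rewrite leq_mul// leq_mul// bitlen_leq// leq_add2l.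
exact: (@leq_bigmax 'I_(G n).+1 (fun g => time_bound n (d n) (N n) g) (Ordinal gG)).
Qed.

End Assembly.

(* Real inputs are unbounded, so the running time is bounded on value matrices
   with polynomially bounded entries, i.e. with O(log n)-bit integer parts;
   the output is correct for all value matrices. *)
Theorem theoremC3 (R : realType) :
  exists P : cmd,
  forall (d : nat -> nat) (Gamma gamma : nat -> R),
    (forall n, (0 < d n)%N) ->
    (fun n => (d n)%:R : R) =O_\oo (fun n => ln (n%:R : R)) ->
    Gamma =o_\oo (fun n => Num.sqrt (ln (n%:R : R))) ->
    (forall n, 0 < gamma n) ->
    (exists c : nat,
      (fun n => (gamma n)^-1%R) =O_\oo (fun n => (n%:R : R) ^+ c)) ->
  forall kappa : nat,
  exists (tau : nat -> nat) (eps : nat -> R),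
    [/\ eps n @[n --> \oo] --> (0 : R),
        (fun n => (tau n)%:R : R) =O_\oo
          (fun n => (n%:R : R) `^ (1 + eps n)) &
        forall (n : nat) (Q1 Q2 Q3 V2 V3 : 'M[R]_(n, d n)),
          (0 < n)%N ->
          entries_le (Gamma n) Q1 ->
          entries_le (Gamma n) Q2 ->
          entries_le (Gamma n) Q3 ->
          exists (t : nat) (s : state R),
            [/\ exec P (input (Gamma n) (gamma n) Q1 Q2 Q3 V2 V3) t s,
                forall (i : 'I_n) (j : 'I_(d n)),
                  `|output n (d n) s i j
                    - strassen_att Q1 Q2 Q3 V2 V3 i j| <= gamma n &
                entries_le (n%:R ^+ kappa) V2 ->
                entries_le (n%:R ^+ kappa) V3 ->
                (t <= tau n)%N]].
Proof.
exists attention_cmd => d Gamma gamma d_gt0 dO Gammao gamma_gt0 [c gammaO] kappa.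
have B0 n : 0 <= 3 * Gamma n * Gamma n by rewrite -mulrA mulr_ge0// sqr_ge0.
(* [N], and [G] below, are chosen as functions of [n] alone; hence the time bound does not depend on
   the matrices. *)
have [N Nmin] := choice (fun n => exists_ceil (B0 n)).
have v0 n : 0 <= value_bound R kappa n (d n) by rewrite !mulr_ge0// !exprn_ge0.
have [G Gmin] := choice (fun n =>
  exists_degree (error_constant_gt0 (N n) (v0 n) (gamma_gt0 n)) (B0 n)).
exists (worst_time d N G), (excess R d N G); split.
- exact: (excess_cvg d_gt0 dO Gammao gamma_gt0 gammaO Nmin Gmin).
- exact: worst_timeO.
- by move=> n Q1 Q2 Q3 V2 V3; exact: (attention_exec gamma_gt0 Nmin Gmin).
Qed.
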